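(* Let $\sigma$ be a sigmoidal function and let $\varphi$ be a convex $\varphi$-function satisfying the $\Delta'$-condition and such that $u\mapsto u^{-\beta}\varphi(u)$, $u>0$, is increasing, for some $\beta>1$. Assume $M^\varphi_{0,1}(\phi_\sigma)<+\infty$. Let $L\ge1$ be the constant of the equivalence between $\varphi$ and a $\varphi$-function $\psi$ with $\psi^{1/\beta}$ convex, i.e. $\psi(t/L)\le\varphi(t)\le\psi(Lt)$ for all $t\ge0$. Then there is a constant $\psi^{\sigma,\varphi}>0$ (independent of $f$, $\lambda$, $n$) such that, for every $f\in W^{1,\varphi}(I)$ and every $\lambda>0$, $$I^\varphi\big[\lambda(K_nf-f)\big]\le\psi^{\sigma,\varphi}\cdot I^\varphi\left[\frac{2L^2\lambda}{n}\,f'\right]$$ for every $n\in\mathbb N$.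
   Context: Let $I=[a,b]\subset\mathbb R$ with $a<b$. Sigmoidal functions. A measurable $\sigma:\mathbb R\to\mathbb R$ is sigmoidal if $\lim_{x\to-\infty}\sigma(x)=0$ and $\lim_{x\to+\infty}\sigma(x)=1$. Here every sigmoidal function is assumed non-decreasing, with $\sigma(1)<1$, and to satisfy: (S1) $\sigma(x)-1/2$ is an odd function; (S2) $\sigma\in C^2(\mathbb R)$ is concave for $x\ge 0$; (S3) $\sigma(x)=\mathcal O(|x|^{-\alpha-1})$ as $x\to-\infty$ for some $\alpha>0$. The density function is $\phi_\sigma(x):=\frac12[\sigma(x+1)-\sigma(x-1)]$, $x\in\mathbb R$. Operators. For $f:I\to\mathbb R$ locally integrable and $n\in\mathbb N$ with $\lceil na\rceil\le\lfloor nb\rfloor-1$ (this is assumed of every $n$ considered), $$(K_nf)(x)=\frac{\sum_{k=\lceil na\rceil}^{\lfloor nb\rfloor-1}\left[n\int_{k/n}^{(k+1)/n}f(u)\,du\right]\phi_\sigma(nx-k)}{\sum_{k=\lceil na\rceil}^{\lfloor nb\rfloor-1}\phi_\sigma(nx-k)},\quad x\in I.$$ Orlicz spaces. A $\varphi$-function is a continuous non-decreasing $\varphi:[0,\infty)\to[0,\infty)$ with $\varphi(0)=0$, $\varphi(u)>0$ for $u>0$, $\lim_{u\to\infty}\varphi(u)=+\infty$. For measurable $f$ on $I$, $I^\varphi[f]:=\int_I\varphi(|f(x)|)\,dx$; $L^\varphi(I)$ is the set of measurable $f$ on $I$ with $I^\varphi[\lambda f]<+\infty$ for some $\lambda>0$.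 The Sobolev-Orlicz space is $W^{1,\varphi}(I):=\{f\in AC(I): f'\in L^\varphi(I)\}$, where $AC(I)$ is the space of absolutely continuous functions $I\to\mathbb R$. $\Delta'$-condition: there exists $C'_\varphi>0$ such that $\varphi(uv)\le C'_\varphi\,\varphi(u)\varphi(v)$ for all $u\ge0$ and $v\ge1$. Moments: for $\nu,\mu\ge0$, $M^\varphi_{\nu,\mu}(\phi_\sigma):=\sup_{u\in\mathbb R}\sum_{k\in\mathbb Z}\phi_\sigma(u-k)\,|u-k|^\nu\,\varphi(|u-k|^\mu)$; so $M^\varphi_{0,1}(\phi_\sigma)=\sup_{u\in\mathbb R}\sum_{k\in\mathbb Z}\phi_\sigma(u-k)\,\varphi(|u-k|)$. It is known (Hästö) that if $u\mapsto u^{-\beta}\varphi(u)$ is increasing on $(0,\infty)$ for some $\beta>1$, then there are a $\varphi$-function $\psi$ and $L\ge1$ with $\psi(t/L)\le\varphi(t)\le\psi(Lt)$ for $t\ge0$ and $\psi^{1/\beta}$ convex, where $\psi^{1/\beta}(x):=(\psi(x))^{1/\beta}$. *)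

(* Defs.v *)
From HB Require Import structures.
From mathcomp Require Import all_boot all_order all_algebra.
From mathcomp Require Import all_classical all_reals all_analysis.

Set Implicit Arguments.
Unset Strict Implicit.
Unset Printing Implicit Defensive.
Import Order.TTheory GRing.Theory Num.Theory.
Import numFieldNormedType.Exports.

Local Open Scope classical_set_scope.
Local Open Scope ring_scope.

(* Functions on I = [a, b] (resp. on [0, +oo[) are represented by functions on
   R of which only the values on `[a, b] (resp. `[0, +oo[) are constrained. *)

Definition C2 (R : realType) (f : R -> R) : Prop :=
  [/\ forall x : R, derivable f x 1, forall x : R, derivable f^`()%classic x 1 &
      continuous f^`(2)%classic].

Record sigmoidal (R : realType) (sigma : R -> R) : Prop := Sigmoidal {
  sigmoidal_meas : measurable_fun setT sigma ;
  sigmoidal_ninfty : sigma x @[x --> -oo] --> (0 : R) ;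
  sigmoidal_pinfty : sigma x @[x --> +oo] --> (1 : R) }.

Record admissible_sigmoidal (R : realType) (sigma : R -> R) : Prop :=
  AdmissibleSigmoidal {
  admissible_sigmoidalW : sigmoidal sigma ;
  admissible_ndecr : {homo sigma : x y / x <= y} ;
  admissible_lt1 : sigma 1 < 1 ;
  admissible_odd : forall x, sigma (- x) - 2^-1 = - (sigma x - 2^-1) ;
  admissible_C2 : C2 sigma ;
  admissible_concave :
    convex_function (`[0, +oo[%classic : set R) (fun x => - sigma x) ;
  admissible_decay : exists2 alpha : R, 0 < alpha &
    exists C : R, \forall x \near -oo,
      `|sigma x| <= C * `|x| `^ (- alpha - 1) }.

Definition density (R : realType) (sigma : R -> R) (x : R) : R :=
  2^-1 * (sigma (x + 1) - sigma (x - 1)).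

Definition kantorovich_range (R : realType) (a b : R) (n : nat) : set int :=
  [set k : int | Num.ceil (n%:R * a) <= k <= Num.floor (n%:R * b) - 1].

Definition kantorovich (R : realType) (sigma : R -> R) (a b : R) (n : nat)
    (f : R -> R) (x : R) : R :=
  (\sum_(k \in kantorovich_range a b n)
     (n%:R * \int[lebesgue_measure]_(u in `[k%:~R / n%:R, (k + 1)%:~R / n%:R])
                f u) * density sigma (n%:R * x - k%:~R))
  / \sum_(k \in kantorovich_range a b n) density sigma (n%:R * x - k%:~R).

Record phi_function (R : realType) (phi : R -> R) : Prop := PhiFunction {
  phi_cont : {within `[0, +oo[, continuous phi} ;
  phi_ndecr : {in `[0, +oo[ &, {homo phi : u v / u <= v}} ;
  phi_0 : phi 0 = 0 ;
  phi_gt0 : forall u : R, 0 < u -> 0 < phi u ;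
  phi_pinfty : phi u @[u --> +oo] --> +oo }.

Definition modular (R : realType) (phi : R -> R) (a b : R) (f : R -> R)
    : \bar R :=
  (\int[lebesgue_measure]_(x in `[a, b]) (phi `|f x|)%:E)%E.

Definition orlicz (R : realType) (phi : R -> R) (a b : R) : set (R -> R) :=
  [set f : R -> R | measurable_fun `[a, b] f /\
    exists2 lambda : R, 0 < lambda &
      (modular phi a b (fun x => lambda * f x)%R < +oo)%E].

Definition absolutely_continuous (R : realType) (a b : R) (f : R -> R) : Prop :=
  forall eps : R, 0 < eps -> exists2 delta : R, 0 < delta &
    forall (m : nat) (l r : 'I_m -> R),
      (forall i, [/\ a <= l i, l i < r i & r i <= b]) ->
      trivIset setT (fun i => `]l i, r i[%classic) ->
      \sum_(i < m) (r i - l i) < delta ->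
      \sum_(i < m) `|f (r i) - f (l i)| < eps.

(* f^`() is total: where f is not differentiable (a null set for f in AC) it
   takes the default value of lim.  At a and b it may depend on the values of f
   outside [a, b], which affects neither measurability nor the modular. *)
Definition sobolev_orlicz (R : realType) (phi : R -> R) (a b : R)
    : set (R -> R) :=
  [set f | absolutely_continuous a b f /\ orlicz phi a b f^`()%classic].

Definition Delta' (R : realType) (phi : R -> R) : Prop :=
  exists2 C : R, 0 < C &
    forall u v : R, 0 <= u -> 1 <= v -> phi (u * v) <= C * phi u * phi v.

(* The convention 0 `^ 0 = 1 of powR is the one needed for nu = 0. *)
Definition moment (R : realType) (phi : R -> R) (nu mu : R) (chi : R -> R)
    : \bar R :=
  ereal_sup [set \esum_(k in [set: int])
      (chi (u - k%:~R) * `|u - k%:~R| `^ nu * phi (`|u - k%:~R| `^ mu))%:E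
    | u in [set: R]].

(* Main.v *)
Require Import Defs.
From HB Require Import structures.
From mathcomp Require Import all_boot all_order all_algebra.
From mathcomp Require Import all_classical all_reals all_analysis.
From mathcomp Require Import measurable_realfun ring lra zify.
Import Order.TTheory GRing.Theory Num.Theory.
Import numFieldNormedType.Exports.
Set Implicit Arguments.
Unset Strict Implicit.
Unset Printing Implicit Defensive.
Local Open Scope classical_set_scope.
Local Open Scope ring_scope.

(** The estimate rests on two facts about one pair of cells of the grid of mesh
    [1 / n]. Let [x] lie in the cell of index [j], let [k] be the index of a
    cell [[k / n, (k + 1) / n]] over which the operator averages [f], and let
    [e] be the distance of [j] and [k].

    For every [u] in the cell [k], the increment [|f u - f x|] is at most the
    integral of [|f'|] over the hull of the two cells, an interval of length
    [(e + 1) / n]. Since [K_n f x - f x] is a convex combination, with the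
    weights of the kernel, of means of [f u - f x] over the cells [k], Jensen's
    inequality bounds [phi (lambda |K_n f x - f x|)] by the same combination of
    the values of [phi] at [lambda] times these integrals
    ([convex_jensen_sum]).

    Jensen's inequality on the hull then turns [phi] of the integral into the
    mean over the hull of [phi (lambda (e + 1) / n |f'|)]
    ([convex_jensen_integral]). For [e >= 2] the Delta'-condition separates
    [phi ((e + 1) / 2)] from [phi (2 lambda / n |f'|)], and monotonicity is
    enough for [e <= 1]; so the kernel times the value of [phi] is at most
    [phi (2 lambda / n |f'|)] times a weight [kappa e] that depends on the
    distance only ([kappa_bound]). As the kernel decreases from [1] on, the
    weights are summable: their sum is controlled by the moment series at the
    single point [u = 0] ([kappa_sum_le]). The denominator of the operator is
    bounded from below by a positive constant, since some node is close to
    [n x] ([density_sum_ge]).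

    Now integrate in [x] and sum over all pairs of cells. A given cell lies in
    the hull of at most [e + 1] pairs at distance [e] on either side, which
    cancels the factor [1 / (e + 1)] of the mean ([sum_between_le]). What is
    left is a constant times the modular of [2 lambda / n f'], and [1 <= L]
    allows the factor [L ^ 2].

    The bound of increments by integrals of [|f'|] is the fundamental theorem
    of calculus for absolutely continuous functions
    ([absolutely_continuous_FTC]). The total variation [v] of [f] and [v - f]
    are nondecreasing and absolutely continuous. The Stieltjes measure of such
    a function vanishes on null sets ([chain_ac_null]), so it has a density by
    the Radon-Nikodym theorem, and Lebesgue's differentiation theorem identifies
    the difference of the two densities with [f'] almost everywhere. *)

(** * Absolute continuity along chains of intervals *)

(** Families of disjoint intervals are listed from left to right, so that
    refining one interval is a surgery on the list. *)
Definition chain (R : realType) (a b : R) (s : seq (R * R)) : bool :=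
  all (fun p => [&& a <= p.1, p.1 < p.2 & p.2 <= b]) s &&
  pairwise (fun p q => p.2 <= q.1) s.

(** The bound on the sum of increments is not strict, so that it survives the
    passage from increments to total variations, which are suprema. *)
Definition chain_absolutely_continuous (R : realType) (a b : R) (f : R -> R) :=
  forall eps : R, 0 < eps -> exists2 delta : R, 0 < delta &
    forall s, chain a b s -> \sum_(p <- s) (p.2 - p.1) < delta ->
      \sum_(p <- s) `|f p.2 - f p.1| <= eps.

Lemma absolutely_continuous_chain (R : realType) (a b : R) (f : R -> R) :
  absolutely_continuous a b f -> chain_absolutely_continuous a b f.
Proof.
move=> acf eps /acf[d d0 H]; exists d => // s.
move=> /andP[sab /(pairwiseP (0, 0)) sdis].
rewrite !(big_nth (0, 0)) !big_mkord => sd; apply/ltW.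
apply: (H _ (fun i : 'I_(size s) => (nth (0, 0) s i).1)
            (fun i : 'I_(size s) => (nth (0, 0) s i).2)) => //.
- by move=> i; have /and3P[] := all_nthP (0, 0) sab i (ltn_ord i).
- suff disj (i j : 'I_(size s)) x : (i < j)%N ->
      `](nth (0, 0) s i).1, (nth (0, 0) s i).2[%classic x ->
      `](nth (0, 0) s j).1, (nth (0, 0) s j).2[%classic x -> False.
    move=> i j _ _ [x [xi xj]]; apply/val_inj.
    by case: (ltngtP i j) => // [/disj|/disj] /(_ x); tauto.
  move=> ij /=; rewrite !in_itv/= => /andP[_ x2] /andP[x1 _].
  have := sdis _ _ (ltn_ord i) (ltn_ord j) ij.
  by rewrite leNgt (lt_trans x1 x2).
Qed.

Fixpoint steps (R : realType) (x : R) (t : seq R) : seq (R * R) :=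
  if t is y :: t' then (x, y) :: steps y t' else [::].

Lemma sum_steps (R : realType) (F : R -> R -> R) (x : R) (t : seq R) :
  \sum_(p <- steps x t) F p.1 p.2 = \sum_(p <- zip t (x :: t)) F p.2 p.1.
Proof. by elim: t x => [x|y t IH x] /=; rewrite ?big_nil// !big_cons IH. Qed.

Lemma sum_steps_length (R : realType) (x : R) (t : seq R) :
  \sum_(p <- steps x t) (p.2 - p.1) = last x t - x.
Proof.
elim: t x => [x|y t IH x] /=; first by rewrite big_nil subrr.
by rewrite big_cons IH /= addrC subrKA.
Qed.

Lemma path_le_last (R : realType) (x : R) (t : seq R) :
  path <%R x t -> x <= last x t.
Proof.
by elim: t x => //= y t IH x /andP[xy /IH]; apply: le_trans; exact: ltW.
Qed.

Lemma steps_within (R : realType) (x : R) (t : seq R) : path <%R x t ->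
  all (fun p => [&& x <= p.1, p.1 < p.2 & p.2 <= last x t]) (steps x t).
Proof.
elim: t x => //= y t IH x /andP[xy yt].
rewrite lexx xy path_le_last//=; apply: sub_all (IH _ yt) => p /and3P[yp -> ->].
by rewrite (le_trans (ltW xy) yp).
Qed.

Lemma steps_pairwise (R : realType) (x : R) (t : seq R) : path <%R x t ->
  pairwise (fun p q => p.2 <= q.1) (steps x t).
Proof.
elim: t x => //= y t IH x /andP[xy yt]; rewrite IH// andbT.
by apply: sub_all (steps_within yt) => p /and3P[].
Qed.

Lemma chain_refine (R : realType) (a b : R) (s1 s2 : seq (R * R)) p t :
  chain a b (s1 ++ p :: s2) -> itv_partition p.1 p.2 t ->
  chain a b (s1 ++ steps p.1 t ++ s2).
Proof.
rewrite /chain !all_cat !pairwise_cat/= allrel_consr allrel_catr.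
move=> /andP[/and3P[s1ab /and3P[ap pp pb] ->]].
move=> /and3P[/andP[s1p s12] -> /andP[ps2 ->]].
move=> [pt /eqP lt]; rewrite s1ab s12 steps_pairwise//= !andbT.
have := steps_within pt; rewrite lt => ptP.
apply/and3P; split.
- apply: sub_all ptP => q /and3P[pq -> qp]; rewrite (le_trans ap pq)//=.
  exact: le_trans qp pb.
- apply/allrelP => q r /(allP s1p) qp /(allP ptP)/and3P[pr _ _].
  exact: le_trans qp pr.
- apply/allrelP => q r /(allP ptP)/and3P[_ _ qp] /(allP ps2).
  exact: le_trans.
Qed.

(** The total variations are replaced one at a time by variations along
    partitions, which turns the chain into a finer one of the same length. *)
Lemma chain_total_variation (R : realType) (a b : R) (f : R -> R) :
  chain_absolutely_continuous a b f ->
  forall eps : R, 0 < eps -> exists2 delta : R, 0 < delta &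
    forall s, chain a b s -> \sum_(p <- s) (p.2 - p.1) < delta ->
      (\sum_(p <- s) total_variation p.1 p.2 f <= eps%:E)%E.
Proof.
move=> acf eps /acf[d d0 H]; exists d => // s sab sd.
suff K s1 s2 : chain a b (s1 ++ s2) ->
    \sum_(p <- s1 ++ s2) (p.2 - p.1) < d ->
    ((\sum_(p <- s1) `|f p.2 - f p.1|)%:E +
      \sum_(p <- s2) total_variation p.1 p.2 f <= eps%:E)%E.
  by have := K [::] s sab sd; rewrite big_nil add0e.
elim: s2 s1 {s sab sd} => [s1|p s2 IH s1].
  by rewrite cats0 big_nil adde0 lee_fin; exact: H.
move=> sab sd; rewrite big_cons.
have [/and3P[ap pp pb] s2ab] : [&& a <= p.1, p.1 < p.2 & p.2 <= b] /\
    all (fun p => [&& a <= p.1, p.1 < p.2 & p.2 <= b]) s2.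
  by move: sab => /andP[]; rewrite all_cat/= => /and3P[].
set S2 := (\sum_(_ <- s2) _)%E.
have S20 : (0 <= S2)%E.
  rewrite /S2 big_seq; apply: sume_ge0 => q /(allP s2ab)/and3P[_ qq _].
  exact/total_variation_ge0/ltW.
have IHt t : itv_partition p.1 p.2 t ->
    ((\sum_(p <- s1) `|f p.2 - f p.1| + variation p.1 p.2 f t)%:E + S2
      <= eps%:E)%E.
  move=> pt.
  have := IH (s1 ++ steps p.1 t); rewrite -!catA => /(_ (chain_refine sab pt)).
  rewrite !big_cat/= sum_steps_length variation_zip//.
  rewrite -(sum_steps (fun u v => `|f v - f u|)); apply.
  by move: sd; rewrite big_cat/= big_cons; case: pt => _ /eqP ->.
(* The supremum over [t] can be moved to one side only past finite terms. *)
have S2fin : S2 \is a fin_num.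
  rewrite ge0_fin_numE// ltey; apply/eqP => S2y.
  by have := IHt _ (itv_partition1 pp); rewrite S2y addey.
move: IHt; rewrite -(fineK S2fin) => IHt.
have TVle : (total_variation p.1 p.2 f <=
    (eps - \sum_(p <- s1) `|f p.2 - f p.1| - fine S2)%:E)%E.
  apply: ge_ereal_sup => _ [_ [t pt <-] <-].
  by have := IHt t pt; rewrite -EFinD !lee_fin; lra.
have TV0 := total_variation_ge0 f (ltW pp).
move: TVle TV0; case: (total_variation p.1 p.2 f) => [r| |]//=.
by rewrite -!EFinD !lee_fin => ? _; lra.
Qed.

Lemma chain1 (R : realType) (a b x y : R) : a <= x -> x < y -> y <= b ->
  chain a b [:: (x, y)].
Proof. by move=> ax xy yb; rewrite /chain/= ax xy yb. Qed.

(** The variation is at most one on each interval of a uniform partition fine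
    enough for the absolute continuity bound of [f] with [eps = 1]. *)
Lemma chain_ac_bounded_variation (R : realType) (a b : R) (f : R -> R) :
  a < b -> chain_absolutely_continuous a b f -> bounded_variation a b f.
Proof.
move=> ab /chain_total_variation/(_ _ ltr01)[d d0 H].
apply/bounded_variationP; first exact: ltW.
pose N := (Num.truncn ((b - a) / d)).+1.
pose h := (b - a) / N%:R.
have N0 : 0 < N%:R :> R by rewrite ltr0n.
have h0 : 0 < h by rewrite divr_gt0// subr_gt0.
have hd : h < d.
  by rewrite /h ltr_pdivrMr// mulrC -ltr_pdivrMr//; exact: truncnS_gt.
suff K k : (k <= N)%N -> (total_variation a (a + k%:R * h) f <= k%:R%:E)%E.
  have := K N (leqnn _); rewrite /h mulrC divfK ?gt_eqF// subrKC => TVN.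
  rewrite ge0_fin_numE; last exact/total_variation_ge0/ltW.
  by rewrite (le_lt_trans TVN)// ltry.
elim: k => [_|k IH kN]; first by rewrite mul0r addr0 total_variationxx.
have kb : a + k.+1%:R * h <= b.
  rewrite -lerBrDl; apply: le_trans (_ : N%:R * h <= _).
    by rewrite ler_pM2r// ler_nat.
  by rewrite /h mulrC divfK ?gt_eqF.
have akh : a <= a + k%:R * h by rewrite lerDl mulr_ge0// ltW.
have kk : a + k%:R * h < a + k.+1%:R * h.
  by rewrite ltrD2l ltr_pM2r// ltr_nat.
rewrite (total_variationD f akh (ltW kk)) -[in leRHS]natr1 EFinD.
apply: leeD; first by apply: IH; exact: ltnW.
have := H _ (chain1 akh kk kb); rewrite !big_seq1/=; apply.
by rewrite opprD addrACA subrr add0r -mulrBl -natr1 addrC addKr mul1r.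
Qed.

Definition tv (R : realType) (a : R) (f : R -> R) (x : R) : R :=
  fine (total_variation a x f).

Lemma tvB (R : realType) (a b : R) (f : R -> R) x y :
  bounded_variation a b f -> a <= x -> x <= y -> y <= b ->
  (tv a f y - tv a f x)%:E = total_variation x y f.
Proof.
move=> bf ax xy yb.
have ay := le_trans ax xy; have xb := le_trans xy yb.
have /(bounded_variationP _ ay) fy : bounded_variation a y f.
  exact: bounded_variationl yb bf.
have /(bounded_variationP _ ax) fx : bounded_variation a x f.
  exact: bounded_variationl xb bf.
by rewrite EFinB /tv !fineK// (total_variationD f ax xy) addeAC subee ?add0e.
Qed.

Lemma ler_norm_tvB (R : realType) (a b : R) (f : R -> R) x y :
  bounded_variation a b f -> a <= x -> x <= y -> y <= b ->
  `|f y - f x| <= tv a f y - tv a f x.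
Proof.
move=> bf ax xy yb; rewrite -lee_fin (tvB bf)//.
exact: total_variation_ge.
Qed.

Lemma chain_ac_tv (R : realType) (a b : R) (f : R -> R) : a < b ->
  chain_absolutely_continuous a b f -> chain_absolutely_continuous a b (tv a f).
Proof.
move=> ab acf; have bf := chain_ac_bounded_variation ab acf.
move=> eps /(chain_total_variation acf)[d d0 H]; exists d => // s sab sd.
rewrite -lee_fin -sumEFin; apply: le_trans (H s sab sd).
rewrite big_seq [leRHS]big_seq; apply: lee_sum => p ps.
have /andP[/allP/(_ p ps)/and3P[ap pp pb] _] := sab.
rewrite -(tvB bf ap (ltW pp) pb) ger0_norm//.
exact: le_trans (normr_ge0 _) (ler_norm_tvB bf ap (ltW pp) pb).
Qed.

Lemma chain_acB (R : realType) (a b : R) (f g : R -> R) :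
  chain_absolutely_continuous a b f -> chain_absolutely_continuous a b g ->
  chain_absolutely_continuous a b (fun x => f x - g x).
Proof.
move=> acf acg eps e0; have e20 : 0 < eps / 2 by rewrite divr_gt0.
have [d d0 H] := acf _ e20; have [e' e'0 K] := acg _ e20.
exists (Num.min d e') => [|s sab]; first by rewrite lt_min d0.
rewrite lt_min => /andP[sd se].
rewrite (splitr eps); apply: le_trans (lerD (H s sab sd) (K s sab se)).
rewrite -big_split/=; apply: ler_sum => p _.
rewrite (_ : _ - _ = (f p.2 - f p.1) - (g p.2 - g p.1)); first exact: ler_normB.
by ring.
Qed.

(** * Densities of absolutely continuous Stieltjes measures *)

Lemma radon_nikodym_restr (R : realType)
    (nu : {measure set (measurableTypeR R) -> \bar R})
    (D : set (measurableTypeR R)) :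
  measurable D -> (nu D < +oo)%E ->
  (forall A : set (measurableTypeR R), measurable A ->
    lebesgue_measure A = 0 -> nu (A `&` D) = 0%E) ->
  exists g : R -> R, [/\ forall x, 0 <= g x,
    lebesgue_measure.-integrable [set: R] (EFin \o g) &
    forall A : set R, measurable A ->
      nu (A `&` D) = (\int[lebesgue_measure]_(x in A) (g x)%:E)%E].
Proof.
move=> mD nuD dom.
pose nuf : {finite_measure set (measurableTypeR R) -> \bar R} := mfrestr mD nuD.
have numu : null_dominates (@lebesgue_measure R) nuf.
  move=> N /= N0 A mA AN; rewrite /nuf /mfrestr /mrestr dom//.
  exact: N0.
have [g [g0 gfin gint gE]] :=
  @radon_nikodym_sigma_finite _ _ R (@lebesgue_measure R) nuf numu.
exists (fine \o g); split => [x||A mA].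
- exact/fine_ge0/g0.
- by rewrite (_ : EFin \o _ = g)//; apply/funext => x /=; rewrite fineK.
- have -> : nu (A `&` D) = nuf A by [].
  by rewrite gE//; apply: eq_integral => x _; rewrite fineK.
Qed.

Definition cell (R : realType) (a h : R) (k : nat) : set R :=
  `]a + k%:R * h, a + k.+1%:R * h]%classic.

Lemma cell_trivIset (R : realType) (a h : R) (n : nat) : 0 < h ->
  trivIset [set: 'I_n] (fun k => cell a h k).
Proof.
move=> h0.
suff disj (i j : nat) x : (i < j)%N -> cell a h i x -> cell a h j x -> False.
  move=> i j _ _ [x [xi xj]]; apply/val_inj.
  by case: (ltngtP i j) => // [/disj|/disj] /(_ x); tauto.
move=> ij; rewrite /cell/= !in_itv/= => /andP[_ xi] /andP[+ _].
rewrite ltNge (le_trans xi)// lerD2l ler_pM2r// ler_nat//.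
Qed.

Lemma cell_cover (R : realType) (a h : R) (n : nat) x :
  a < x -> x <= a + n%:R * h -> exists k : 'I_n, cell a h k x.
Proof.
elim: n => [ax|n IH ax xn]; first by rewrite mul0r addr0 leNgt ax.
have [/(IH ax)[k kx]|xgt] := leP x (a + n%:R * h).
  by exists (widen_ord (leqnSn n) k).
by exists ord_max; rewrite /cell/= in_itv/= xgt.
Qed.

Lemma cell_chain (R : realType) (a b h : R) (n : nat) (P : pred nat) :
  0 < h -> a + n%:R * h <= b ->
  chain a b [seq (a + k%:R * h, a + k.+1%:R * h) | k <- iota 0 n & P k].
Proof.
move=> h0 nb; apply/andP; split.
  apply/allP => _ /mapP[k + ->] /=.
  rewrite mem_filter mem_iota add0n => /andP[_ kn].
  rewrite lerDl mulr_ge0 ?(ltW h0)//= ltrD2l ltr_pM2r// ltr_nat ltnSn/=.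
  by rewrite (le_trans _ nb)// lerD2l ler_pM2r// ler_nat.
rewrite pairwise_map; apply: pairwise_filter.
have := iota_ltn_sorted 0 n; rewrite sorted_pairwise; last exact: ltn_trans.
apply: sub_pairwise => i j /= ij.
by rewrite lerD2l ler_pM2r// ler_nat.
Qed.

(** A null set lies in an open set [U] of small length. The union [W n] of the
    cells of mesh [h n] contained in [U] is a chain of total length at most that
    of [U], so its measure is small by absolute continuity; and every point of
    [U] between [a] and [b] belongs to [W n] for all large [n]. *)
Lemma chain_ac_null (R : realType) (a b : R) (F : R -> R)
    (nu : {measure set (measurableTypeR R) -> \bar R}) : a < b ->
  (forall x y, a <= x -> x <= y -> y <= b ->
    nu (`]x, y]%classic : set R) = (F y - F x)%:E) ->
  chain_absolutely_continuous a b F ->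
  forall A : set (measurableTypeR R), measurable A ->
    lebesgue_measure A = 0 -> nu (A `&` `]a, b]%classic) = 0%E.
Proof.
move=> ab nuE acF A mA A0; apply/eqP; rewrite eq_le measure_ge0 andbT.
apply/lee_addgt0Pr => eps eps0; rewrite add0e.
have [d d0 H] := acF _ eps0.
have Afin : (lebesgue_measure A < +oo)%E by rewrite A0 ltry.
have [U [oU AU UAd]] := @lebesgue_regularity_outer R A d mA Afin d0.
have mU : measurable U by exact: open_measurable.
have Ud : (lebesgue_measure U < d%:E)%E.
  apply: le_lt_trans UAd; rewrite -[leRHS]add0e -A0 -[in leLHS](setDUK AU).
  by apply: measureU2 => //; exact: measurableD.
pose h n : R := (b - a) / n.+1%:R.
have h0 n : 0 < h n by rewrite divr_gt0// ?subr_gt0// ltr0n.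
have nh n : a + n.+1%:R * h n = b.
  by rewrite /h mulrC divfK ?pnatr_eq0// subrKC.
pose P n : pred nat := fun k => `[<cell a (h n) k `<=` U>].
pose W n : set (measurableTypeR R) :=
  \big[setU/set0]_(k < n.+1 | P n k) cell a (h n) k.
have mcell n k : measurable (cell a (h n) k : set R) by exact: measurable_itv.
have mucell n k : lebesgue_measure (cell a (h n) k) =
    ((a + k.+1%:R * h n) - (a + k%:R * h n))%:E.
  rewrite /cell lebesgue_measure_itv/= lte_fin.
  by rewrite ltrD2l ltr_pM2r// ltr_nat ltnSn EFinB.
have mW n : measurable (W n) by apply: bigsetU_measurable => k _; exact: mcell.
have WU n : W n `<=` U.
  by rewrite /W -bigcup_pred => x [k /asboolP]; apply.
have nuW n : (nu (W n) <= eps%:E)%E.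
  pose s := [seq (a + k%:R * h n, a + k.+1%:R * h n)
            | k <- iota 0 n.+1 & P n k].
  have sab : chain a b s by apply: cell_chain => //; rewrite nh.
  have bs (G : R * R -> R) : \sum_(p <- s) G p =
      \sum_(k < n.+1 | P n k) G (a + k%:R * h n, a + k.+1%:R * h n).
    by rewrite big_map big_filter -/(index_iota 0 n.+1) big_mkord.
  have kE (k : 'I_n.+1) : [/\ a <= a + k%:R * h n,
      a + k%:R * h n <= a + k.+1%:R * h n & a + k.+1%:R * h n <= b].
    split; first by rewrite lerDl mulr_ge0// ltW.
      by rewrite lerD2l ler_pM2r// ler_nat.
    by rewrite -(nh n) lerD2l ler_pM2r// ler_nat.
  rewrite /W measure_bigsetU_ord;
    [|by move=> k; exact: mcell|exact: cell_trivIset].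
  have -> : (\sum_(k < n.+1 | P n k) nu (cell a (h n) k) =
      (\sum_(p <- s) (F p.2 - F p.1))%:E)%E.
    rewrite bs -sumEFin; apply: eq_bigr => k _ /=.
    by have [? ? ?] := kE k; exact: nuE.
  rewrite lee_fin; apply: le_trans (H s sab _).
    by apply: ler_sum => p _; exact: ler_norm.
  rewrite -lte_fin; apply: le_lt_trans Ud.
  rewrite bs -sumEFin; apply: le_trans (_ : lebesgue_measure (W n) <= _)%E.
    rewrite /W measure_bigsetU_ord;
      [|by move=> k; exact: mcell|exact: cell_trivIset].
    by apply: lee_sum => k _; rewrite -mucell.
  by apply: (le_measure (@lebesgue_measure R)); rewrite ?inE//; exact: WU.
(* The sets [W n] need not increase with [n], but their tails [V n] do. *)
pose V n := \bigcap_(m in [set m | (n <= m)%N]) W m.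
have mV n : measurable (V n) by apply: bigcap_measurable => //; exists n => /=.
have VE : A `&` `]a, b]%classic `<=` \bigcup_n V n.
  move=> x [/AU Ux] /=; rewrite in_itv/= => /andP[ax xb].
  have /nbhs_ballP[e /= e0 eU] := open_nbhs_nbhs (conj oU Ux).
  exists (Num.truncn ((b - a) / e)) => // m /= me.
  have he : h m < e.
    rewrite /h ltr_pdivrMr ?ltr0n// mulrC -ltr_pdivrMr//.
    by apply: lt_le_trans (truncnS_gt _) _; rewrite ler_nat ltnS.
  have [|k kx] := @cell_cover R a (h m) m.+1 x ax; first by rewrite nh.
  rewrite /W -bigcup_pred; exists k => //; apply/asboolP => y yk; apply: eU.
  move: kx yk; rewrite /cell/= !in_itv/= -natr1 mulrDl mul1r addrA.
  by move=> /andP[x1 x2] /andP[y1 y2]; rewrite /ball/= ltr_norml; lra.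
apply: le_trans (_ : nu (\bigcup_n V n) <= _)%E.
  apply: le_measure; rewrite ?inE//; last exact: bigcup_measurable.
  by apply: measurableI => //; exact: measurable_itv.
have cV : nu \o V @ \oo --> nu (\bigcup_n V n).
  apply: nondecreasing_cvg_mu => //; first exact: bigcup_measurable.
  move=> n m nm; apply/subsetPset => x Vx k /= mk; apply: Vx => /=.
  exact: leq_trans mk.
rewrite -(cvg_lim _ cV)//; apply: lime_le.
  by apply/cvg_ex; exists (nu (\bigcup_n V n)).
apply: nearW => n /=; apply: le_trans (nuW n).
apply: le_measure; rewrite ?inE// => x; apply => /=.
exact: leqnn.
Qed.

(** Precomposition with [clamp a b] extends a function on [a, b] continuously
    to the line, as Stieltjes measures require. *)
Definition clamp (R : realType) (a b x : R) : R := Num.min b (Num.max a x).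

Lemma clamp_within (R : realType) (a b x : R) : a <= b ->
  a <= clamp a b x <= b.
Proof. by move=> ab; rewrite /clamp le_min ab le_max lexx/= ge_min lexx. Qed.

Lemma clamp_id (R : realType) (a b x : R) : a <= x -> x <= b ->
  clamp a b x = x.
Proof. by move=> ax xb; rewrite /clamp (max_idPr ax) (min_idPr xb). Qed.

Lemma clamp_ndecr (R : realType) (a b x y : R) : x <= y ->
  clamp a b x <= clamp a b y.
Proof. by move=> xy; rewrite le_min2//= le_max2. Qed.

Lemma clampB_le (R : realType) (a b x y : R) : x <= y ->
  clamp a b y - clamp a b x <= y - x.
Proof.
move=> xy; have min_le u v : u <= v -> Num.min b v - Num.min b u <= v - u.
  by move=> uv; case: (leP b u) => ?; case: (leP b v) => ?; lra.
have max_le : Num.max a y - Num.max a x <= y - x.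
  by case: (leP a x) => ?; case: (leP a y) => ?; lra.
by apply: le_trans max_le; apply: min_le; rewrite le_max2.
Qed.

Lemma chain_ac_clamp_continuous (R : realType) (a b : R) (f : R -> R) :
  a <= b -> chain_absolutely_continuous a b f -> continuous (f \o clamp a b).
Proof.
move=> ab acf x; apply/cvgrPdist_le => eps eps0.
have [d d0 H] := acf _ eps0.
have near_le u v : u <= v -> v - u < d ->
    `|f (clamp a b v) - f (clamp a b u)| <= eps.
  move=> uv vud.
  have [|e] := ltP (clamp a b u) (clamp a b v); last first.
    have -> : clamp a b v = clamp a b u.
      by apply/eqP; rewrite eq_le e clamp_ndecr.
    by rewrite subrr normr0 ltW.
  move=> uvlt; have /andP[ua _] := clamp_within u ab.
  have /andP[_ vb] := clamp_within v ab.
  have := H _ (chain1 ua uvlt vb); rewrite !big_seq1/=; apply.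
  exact: le_lt_trans (clampB_le _ _ uv) vud.
near=> y.
have : `|x - y| < d by near: y; exact: cvgr_dist_lt.
rewrite ltr_norml /= => /andP[xy1 xy2].
have [xy|/ltW yx] := leP x y; last exact: near_le.
by rewrite distrC; apply: near_le => //; lra.
Unshelve. all: by end_near. Qed.

(** The density of the Stieltjes measure of [F] with respect to the Lebesgue
    measure exists because the former vanishes on null sets. *)
Lemma nondecreasing_chain_ac_density (R : realType) (a b : R) (F : R -> R) :
  a < b -> {in `[a, b] &, {homo F : x y / x <= y}} ->
  chain_absolutely_continuous a b F ->
  exists g : R -> R,
    lebesgue_measure.-integrable [set: R] (EFin \o g) /\
    forall x, a <= x -> x <= b ->
      F x - F a = \int[lebesgue_measure]_(t in `[a, x]) g t.
Proof.
move=> ab ndF acF; pose G := F \o clamp a b.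
have leab := ltW ab.
have nd : {homo G : x y / x <= y}.
  by move=> x y xy; apply: ndF; rewrite ?in_itv/= ?clamp_within// clamp_ndecr.
have rc : lebesgue_stieltjes_measure.right_continuous G.
  by move=> x; apply: cvg_at_right_filter; exact: chain_ac_clamp_continuous.
pose Gc : cumulative R R := HB.pack G (isCumulative.Build R _ R G nd rc).
pose nu : {measure set (measurableTypeR R) -> \bar R} :=
  lebesgue_stieltjes_measure Gc.
have nuE x y : a <= x -> x <= y -> y <= b ->
    nu (`]x, y]%classic : set R) = (F y - F x)%:E.
  move=> ax xy yb; have -> : nu `]x, y]%classic =
      lebesgue_stieltjes_measure Gc `]x, y]%classic by [].
  rewrite /lebesgue_stieltjes_measure /measure_extension.
  rewrite measurable_mu_extE/=; last exact: is_ocitv.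
  rewrite wlength_itv_bnd//= /G/= !clamp_id//; first exact: le_trans xy yb.
  exact: le_trans ax xy.
have [|||g [g0 intg gE]] := @radon_nikodym_restr R nu `]a, b]%classic.
- exact: measurable_itv.
- by rewrite nuE// ltry.
- exact: (chain_ac_null ab nuE acF).
exists g; split => // x ax xb.
have mI : measurable (`]a, x]%classic : set R) by exact: measurable_itv.
rewrite -Rintegral_itv_obnd_cbnd; last exact: integrableS intg.
rewrite /Rintegral -gE// setIidl ?nuE// => y /=.
by rewrite !in_itv/= => /andP[-> /le_trans]; apply.
Qed.

(** [f] is the difference of [tv a f] and [tv a f - f], both nondecreasing and
    absolutely continuous. *)
Theorem absolutely_continuous_FTC (R : realType) (a b : R) (f : R -> R) :
  a < b -> absolutely_continuous a b f ->
  exists g : R -> R, [/\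
    lebesgue_measure.-integrable [set: R] (EFin \o g),
    forall x, a <= x -> x <= b ->
      f x - f a = \int[lebesgue_measure]_(t in `[a, x]) g t &
    ae_eq lebesgue_measure `]a, b[%classic f^`()%classic g].
Proof.
move=> ab /absolutely_continuous_chain acf.
have bf := chain_ac_bounded_variation ab acf.
have acv := chain_ac_tv ab acf.
have incr x y : x \in `[a, b] -> y \in `[a, b] -> x <= y ->
    `|f y - f x| <= tv a f y - tv a f x.
  rewrite !in_itv/= => /andP[ax xb] /andP[ay yb] xy.
  exact: (ler_norm_tvB bf).
have [x y xab yab xy|g1 [ig1 g1E]] := nondecreasing_chain_ac_density ab _ acv.
  by rewrite -subr_ge0; exact: le_trans (incr _ _ xab yab xy).
have [x y xab yab xy|g2 [ig2 g2E]] :=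
    nondecreasing_chain_ac_density ab _ (chain_acB acv acf).
  by have := le_trans (ler_norm _) (incr _ _ xab yab xy); lra.
pose g x := g1 x - g2 x.
have ig : lebesgue_measure.-integrable [set: R] (EFin \o g).
  rewrite (_ : _ \o _ = (EFin \o g1) \- (EFin \o g2))%E.
    exact: integrableB.
  by apply/funext => x /=; rewrite EFinB.
have gE x : a <= x -> x <= b ->
    f x - f a = \int[lebesgue_measure]_(t in `[a, x]) g t.
  move=> ax xb; rewrite RintegralB//; last 2 first.
    by apply: integrableS ig1.
    by apply: integrableS ig2.
  by rewrite -g1E// -g2E//; ring.
exists g; split => //.
pose F y := \int[lebesgue_measure]_(t in `[a, y]) g t.
have iy y : lebesgue_measure.-integrable `[a, y] (EFin \o g).
  by apply: integrableS ig.
have := FTC1 iy (open_integrable_locally openT ig).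
apply: filterS; first exact: (ae_filter_ringOfSetsType lebesgue_measure).
move=> x dF /=; rewrite in_itv/= => /andP[ax xb].
have [|dFx <-] := dF; first by rewrite lte_fin.
rewrite !derive1E (@near_eq_derive _ _ _ f (fun y => F y + f a)).
  by rewrite deriveD// derive_cst addr0.
near=> y.
have ay : a <= y by near: y; exact: lt_le_nbhsr.
have yb : y <= b by near: y; exact: lt_le_nbhsl.
by rewrite /F -gE// subrK.
Unshelve. all: by end_near. Qed.

Lemma ae_eq_itv_oo_cc (R : realType) (T : Type) (a b : R) (f g : R -> T) :
  ae_eq lebesgue_measure `]a, b[%classic f g ->
  ae_eq lebesgue_measure `[a, b]%classic f g.
Proof.
move=> fg; have neg1 (x : R) : lebesgue_measure.-negligible [set x].
  by apply/negligibleP; [exact: measurable_set1|exact: lebesgue_measure_set1].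
have : lebesgue_measure.-negligible
    (~` [set x | `[a, b]%classic x -> f x = g x]); last by [].
apply: (negligibleS _ (negligibleU fg (negligibleU (neg1 a) (neg1 b)))) => x.
move=> /= /not_implyP[]; rewrite in_itv/= => /andP[ax xb] fgx.
have [->|xa] := eqVneq x a; first by right; left.
have [->|xb'] := eqVneq x b; first by right; right.
left => /= H; apply: fgx; apply: H.
by rewrite in_itv/= !lt_neqAle eq_sym xa ax xb' xb.
Qed.

(** The derivative may replace the density of [f] in integrals over [a, b],
    since the two agree almost everywhere. *)
Lemma absolutely_continuous_derive_integrable (R : realType) (a b : R)
    (f : R -> R) : a < b -> absolutely_continuous a b f ->
  measurable_fun `[a, b] f^`()%classic ->
  lebesgue_measure.-integrable `[a, b] (EFin \o f^`()%classic) /\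
  forall x y, a <= x -> x <= y -> y <= b ->
    `|f y - f x| <= \int[lebesgue_measure]_(t in `[x, y]) `|f^`()%classic t|.
Proof.
move=> ab acf mf'.
have [g [ig gE /ae_eq_itv_oo_cc aeg]] := absolutely_continuous_FTC ab acf.
have mabs (D : set R) (h : R -> R) : measurable D -> measurable_fun D h ->
    measurable_fun D (fun t => (`|h t|)%:E).
  by move=> mD mh; apply/measurable_EFinP; exact: measurableT_comp.
have mg D : measurable D -> measurable_fun D g.
  move=> mD; apply: (measurable_funS measurableT) => //.
  by have /integrableP[/measurable_EFinP] := ig.
have abs_eq (D : set R) : measurable D -> D `<=` `[a, b]%classic ->
    (\int[lebesgue_measure]_(t in D) (`|f^`()%classic t|)%:E =
     \int[lebesgue_measure]_(t in D) (`|g t|)%:E)%E.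
  move=> mD Dab; apply: ge0_ae_eq_integral => //.
  - by apply: mabs => //; exact: measurable_funS mf'.
  - by apply: mabs => //; exact: mg.
  - case: aeg => N [mN N0 NP]; exists N; split => //.
    by apply: subset_trans NP => t /= nH H; apply: nH => /Dab /H ->.
split.
  apply/integrableP; split; first exact/measurable_EFinP.
  under eq_integral do rewrite abse_EFin.
  rewrite abs_eq//.
  have : lebesgue_measure.-integrable `[a, b] (EFin \o g).
    by apply: integrableS ig.
  by move=> /integrableP[_].
move=> x y ax xy yb.
have xyab : `[x, y]%classic `<=` `[a, b]%classic.
  by apply: subset_itv; rewrite bnd_simp.
have igD D : measurable D -> lebesgue_measure.-integrable D (EFin \o g).
  by move=> mD; apply: integrableS ig.
rewrite /Rintegral abs_eq//.
apply: le_trans (le_normr_Rintegral _ (igD _ _)) => //.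
rewrite (_ : f y - f x = (f y - f a) - (f x - f a)); last by ring.
rewrite !gE ?(le_trans _ yb) ?(le_trans ax)// Rintegral_itvB ?bnd_simp//.
  rewrite Rintegral_itv_obnd_cbnd//; exact: igD.
exact: igD.
Qed.

(** * Jensen's inequality by supporting lines *)

Lemma convex_functionP (R : realType) (D : set R) (f : R -> R) :
  convex_function (D : set (convex_lmodType R^o)) f ->
  forall t x y, 0 <= t -> t <= 1 -> D x -> D y ->
    f (t * x + (1 - t) * y) <= t * f x + (1 - t) * f y.
Proof.
move=> cf t x y t0 t1 Dx Dy.
by have := cf (Itv01 t0 t1) x y; rewrite !inE !convRE/=; apply.
Qed.

Lemma convex_slope (R : realType) (f : R -> R) (u v w : R) :
  convex_function (`[0, +oo[%classic : set R) f ->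
  0 <= u -> u < v -> v < w ->
  (f v - f u) / (v - u) <= (f w - f v) / (w - v).
Proof.
move=> cf u0 uv vw.
have wu : 0 < w - u by lra.
have vu : 0 < v - u by lra.
have wv : 0 < w - v by lra.
have /= := @convex_functionP _ _ _ cf ((w - v) / (w - u)) u w.
rewrite !in_itv/= !andbT => /(_ _ _ u0).
have -> : (w - v) / (w - u) * u + (1 - (w - v) / (w - u)) * w = v.
  by field; rewrite gt_eqF.
move=> H; have {H} : f v <= (w - v) / (w - u) * f u +
    (1 - (w - v) / (w - u)) * f w.
  by apply: H; [rewrite divr_ge0 ?ltW|rewrite ler_pdivrMr ?mul1r//; lra|lra].
have -> : (w - v) / (w - u) * f u + (1 - (w - v) / (w - u)) * f w =
    ((w - v) * f u + (v - u) * f w) / (w - u).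
  by field; rewrite gt_eqF.
rewrite ler_pdivlMr// => H.
rewrite ler_pdivlMr// mulrAC ler_pdivrMr//; lra.
Qed.

(** The slope is the supremum of the slopes of the chords from the left; at
    [u = 0], where there are none, monotonicity allows a horizontal line. *)
Lemma convex_support (R : realType) (f : R -> R) (u : R) :
  convex_function (`[0, +oo[%classic : set R) f ->
  {in `[0, +oo[ &, {homo f : x y / x <= y}} -> 0 <= u ->
  exists c, forall v, 0 <= v -> f u + c * (v - u) <= f v.
Proof.
move=> cf ndf; rewrite le_eqVlt => /predU1P[<-|u0].
  by exists 0 => v v0; rewrite mul0r addr0 ndf// ?in_itv/= ?andbT.
pose S := [set (f u - f z) / (u - z) | z in `[0, u[%classic].
have S0 : S !=set0.
  by exists ((f u - f 0) / (u - 0)), 0 => //=; rewrite in_itv/= lexx.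
have ubS w : u < w -> ubound S ((f w - f u) / (w - u)).
  move=> uw _ [z /= + <-]; rewrite in_itv/= => /andP[z0 zu].
  exact: convex_slope.
have supS : has_sup S.
  split => //; exists ((f (u + 1) - f u) / (u + 1 - u)).
  by apply: ubS; rewrite ltrDl.
exists (sup S) => v v0.
have [vu|uv|->] := ltgtP v u; last by rewrite subrr mulr0 addr0.
- have : (f u - f v) / (u - v) <= sup S.
    apply: ub_le_sup; first by case: supS.
    by exists v => //=; rewrite in_itv/= v0.
  by rewrite ler_pdivrMr ?subr_gt0//; lra.
- have : sup S <= (f v - f u) / (v - u) by apply: ge_sup => //; exact: ubS.
  by rewrite ler_pdivlMr ?subr_gt0//; lra.
Qed.

Lemma convex_jensen_sum (R : realType) (f : R -> R) (I : finType)
    (w x : I -> R) :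
  convex_function (`[0, +oo[%classic : set R) f ->
  {in `[0, +oo[ &, {homo f : x y / x <= y}} ->
  (forall i, 0 <= w i) -> (forall i, 0 <= x i) -> \sum_i w i = 1 ->
  f (\sum_i w i * x i) <= \sum_i w i * f (x i).
Proof.
move=> cf ndf w0 x0 w1; set u := \sum_i _ * x i.
have u0 : 0 <= u by apply: sumr_ge0 => i _; rewrite mulr_ge0.
have [c cP] := convex_support cf ndf u0.
rewrite -[leLHS]mulr1 -w1 mulr_sumr.
suff -> : \sum_i f u * w i = \sum_i w i * (f u + c * (x i - u)).
  by apply: ler_sum => i _; apply: ler_wpM2l => //; exact: cP.
under [RHS]eq_bigr do rewrite mulrDr mulrCA mulrBr.
rewrite big_split/= -[LHS]addr0; congr (_ + _).
  by apply: eq_bigr => i _; rewrite mulrC.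
by rewrite -mulr_sumr sumrB -mulr_suml w1 mul1r subrr mulr0.
Qed.

Lemma finite_integrable_cst (R : realType) (E : set (measurableTypeR R))
    (k : R) :
  measurable E -> lebesgue_measure E \is a fin_num ->
  lebesgue_measure.-integrable E (EFin \o cst k).
Proof.
move=> mE Efin; apply/integrableP; split; first exact/measurable_EFinP.
rewrite (_ : (fun x => _) = cst `|k|%:E)//.
by rewrite integral_cst//= -(fineK Efin) -EFinM ltry.
Qed.

Lemma finite_Rintegral_cst (R : realType) (E : set (measurableTypeR R))
    (k : R) :
  measurable E -> lebesgue_measure E \is a fin_num ->
  \int[lebesgue_measure]_(x in E) (cst k x) = k * fine (lebesgue_measure E).
Proof.
move=> mE Efin; have -> : \int[lebesgue_measure]_(x in E) (cst k x) =
  fine (\int[lebesgue_measure]_(x in E) cst k%:E x)%E by [].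
by rewrite integral_cst//= -(fineK Efin) -EFinM.
Qed.

(** A length [l] larger than that of [E] is allowed because [f] vanishes at
    [0], which amounts to extending [u] by zero. Integrability is asked of a
    majorant [h] of [f (l * u x)], since a pointwise bound of the latter is what
    applications provide. *)
Lemma convex_jensen_integral (R : realType) (f : R -> R)
    (E : set (measurableTypeR R)) (l : R) (u h : R -> R) :
  convex_function (`[0, +oo[%classic : set R) f ->
  {in `[0, +oo[ &, {homo f : x y / x <= y}} -> f 0 = 0 ->
  measurable E -> (lebesgue_measure E <= l%:E)%E -> 0 <= l ->
  lebesgue_measure.-integrable E (EFin \o u) ->
  lebesgue_measure.-integrable E (EFin \o h) ->
  (forall x, 0 <= u x) -> (forall x, E x -> f (l * u x) <= h x) ->
  l * f (\int[lebesgue_measure]_(x in E) u x) <=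
    \int[lebesgue_measure]_(x in E) h x.
Proof.
move=> cf ndf f0 mE El l0 iu ih u0 fh.
set U := \int[_]_(_ in _) u _.
have U0 : 0 <= U by apply: Rintegral_ge0.
have [c cP] := convex_support cf ndf U0.
pose k := f U - c * U.
have k0 : k <= 0 by have := cP 0 (lexx _); rewrite f0 /k; lra.
have Efin : lebesgue_measure E \is a fin_num.
  by rewrite ge0_fin_numE// (le_lt_trans El)// ltry.
have El' : fine (lebesgue_measure E) <= l by rewrite -lee_fin fineK.
have icst : lebesgue_measure.-integrable E (EFin \o cst k).
  exact: finite_integrable_cst.
have iul : lebesgue_measure.-integrable E (EFin \o (fun x => c * l * u x)).
  rewrite (_ : _ \o _ = (fun x => (c * l)%:E * (EFin \o u) x)%E)//.
  exact: integrableZl.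
apply: le_trans (_ : \int[lebesgue_measure]_(x in E)
    (k + c * l * u x) <= _); last first.
  apply: le_Rintegral => //.
    exact: (integrableD mE icst iul).
  move=> x Ex; apply: le_trans (fh _ Ex).
  by apply: le_trans (cP (l * u x) _); [rewrite /k; lra|rewrite mulr_ge0].
rewrite RintegralD// finite_Rintegral_cst// RintegralZl// -/U.
have -> : l * f U = k * l + c * l * U by rewrite /k; ring.
by rewrite lerD2r; exact: ler_wnM2l.
Qed.

(** * The kernel *)

Lemma sigmoidal_reflect (R : realType) (sigma : R -> R) x :
  admissible_sigmoidal sigma -> sigma (- x) = 1 - sigma x.
Proof. by case=> _ _ _ /(_ x) + _ _ _; lra. Qed.

Lemma sigmoidal_le1 (R : realType) (sigma : R -> R) x :
  admissible_sigmoidal sigma -> sigma x <= 1.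
Proof.
case=> -[_ _ sy] nd _ _ _ _ _; rewrite leNgt; apply/negP => x1.
near (pinfty_nbhs R) => y.
have : sigma y < sigma x by near: y; exact: cvgr_lt sy _ x1.
by rewrite ltNge nd.
Unshelve. all: by end_near. Qed.

Lemma sigmoidal_ge0 (R : realType) (sigma : R -> R) x :
  admissible_sigmoidal sigma -> 0 <= sigma x.
Proof.
move=> sP; rewrite -[x]opprK (sigmoidal_reflect _ sP) subr_ge0.
exact: sigmoidal_le1.
Qed.

Lemma sigmoidal_concave (R : realType) (sigma : R -> R) t x y :
  admissible_sigmoidal sigma -> 0 <= t -> t <= 1 -> 0 <= x -> 0 <= y ->
  t * sigma x + (1 - t) * sigma y <= sigma (t * x + (1 - t) * y).
Proof.
case=> _ _ _ _ _ cs _ t0 t1 x0 y0.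
have := @convex_functionP _ _ _ cs t x y t0 t1.
by rewrite /= !in_itv/= x0 y0 => /(_ isT isT); lra.
Qed.

(** [sigma] cannot be constant on [1, 2]: by concavity it would be constant
    from there on, below its limit. *)
Lemma sigmoidal_lt12 (R : realType) (sigma : R -> R) :
  admissible_sigmoidal sigma -> sigma 1 < sigma 2.
Proof.
move=> sP; have [[_ _ sy] nd s1 _ _ _ _] := sP.
near (pinfty_nbhs R) => y.
have y2 : 2 < y by near: y; exact: nbhs_pinfty_gt.
have sy1 : sigma 1 < sigma y by near: y; exact: cvgr_gt sy _ s1.
have y1 : 0 < y - 1 by lra.
have y0 : 0 <= y by lra.
pose t := (y - 2) / (y - 1).
have t0 : 0 <= t by rewrite divr_ge0; lra.
have t1 : t < 1 by rewrite /t ltr_pdivrMr// mul1r; lra.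
have := sigmoidal_concave sP t0 (ltW t1) ler01 y0.
have -> : t * 1 + (1 - t) * y = 2 by rewrite /t; field; rewrite gt_eqF.
apply: lt_le_trans; have : 0 < (1 - t) * (sigma y - sigma 1).
  by rewrite mulr_gt0 ?subr_gt0.
by rewrite mulrBr; lra.
Unshelve. all: by end_near. Qed.

Lemma density_ge0 (R : realType) (sigma : R -> R) x :
  admissible_sigmoidal sigma -> 0 <= density sigma x.
Proof.
case=> _ nd _ _ _ _ _; rewrite /density mulr_ge0// subr_ge0 nd//; lra.
Qed.

Lemma density_even (R : realType) (sigma : R -> R) x :
  admissible_sigmoidal sigma -> density sigma (- x) = density sigma x.
Proof.
move=> sP; rewrite /density.
have -> : - x + 1 = - (x - 1) by ring.
have -> : - x - 1 = - (x + 1) by ring.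
by rewrite !(sigmoidal_reflect _ sP); ring.
Qed.

Lemma density_norm (R : realType) (sigma : R -> R) x :
  admissible_sigmoidal sigma -> density sigma `|x| = density sigma x.
Proof.
move=> sP; case: (ger0P x) => // _; exact: density_even.
Qed.

Lemma density_le_half (R : realType) (sigma : R -> R) x :
  admissible_sigmoidal sigma -> density sigma x <= 2^-1.
Proof.
move=> sP; rewrite /density.
have := sigmoidal_le1 (x + 1) sP; have := sigmoidal_ge0 (x - 1) sP; lra.
Qed.

(** The window [[x - 1, x + 1]] stays in the half line where [sigma] is concave,
    so the increment over it decreases as it moves to the right. *)
Lemma density_nincr (R : realType) (sigma : R -> R) x y :
  admissible_sigmoidal sigma -> 1 <= x -> x <= y ->
  density sigma y <= density sigma x.
Proof.
move=> sP x1 xy.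
have yx : 0 < y - x + 2 by lra.
pose t := (y - x) / (y - x + 2).
have t0 : 0 <= t by rewrite divr_ge0; lra.
have t1 : t <= 1 by rewrite /t ler_pdivrMr// mul1r; lra.
have xm : 0 <= x - 1 by lra.
have yp : 0 <= y + 1 by lra.
have := sigmoidal_concave sP t0 t1 xm yp.
have := sigmoidal_concave sP t0 t1 yp xm.
have -> : t * (x - 1) + (1 - t) * (y + 1) = x + 1.
  by rewrite /t; field; rewrite gt_eqF.
have -> : t * (y + 1) + (1 - t) * (x - 1) = y - 1.
  by rewrite /t; field; rewrite gt_eqF.
by rewrite /density; lra.
Qed.

Definition density_min (R : realType) (sigma : R -> R) : R :=
  2^-1 * (sigma 2 - sigma 1).

Lemma density_min_gt0 (R : realType) (sigma : R -> R) :
  admissible_sigmoidal sigma -> 0 < density_min sigma.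
Proof. by move=> /sigmoidal_lt12 s12; rewrite mulr_gt0// subr_gt0. Qed.

(** For [x] between [0] and [1] the window [[x - 1, x + 1]] contains [[0, 1]],
    for [x] between [1] and [2] it contains [[1, 2]]; of the two unit intervals
    the latter has the smaller increment, by concavity. *)
Lemma density_min_le (R : realType) (sigma : R -> R) x :
  admissible_sigmoidal sigma -> `|x| <= 2 ->
  density_min sigma <= density sigma x.
Proof.
move=> sP; rewrite -(density_norm _ sP); move: `|x| (normr_ge0 x) => y.
move=> y0 y2; have [_ nd _ _ _ _ _] := sP.
rewrite /density /density_min ler_pM2l//.
have [y1|/ltW y1] := leP 1 y.
  by rewrite lerB ?nd//; lra.
have s01 : sigma 2 - sigma 1 <= sigma 1 - sigma 0.
  have h0 : (0 : R) <= 2^-1 by lra.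
  have h1 : (2^-1 : R) <= 1 by lra.
  have := sigmoidal_concave sP h0 h1 (lexx 0) (ler0n _ 2).
  have -> : 2^-1 * 0 + (1 - 2^-1) * 2 = 1 :> R by lra.
  by lra.
by apply: le_trans s01 _; rewrite lerB ?nd//; lra.
Qed.

(** * Weights that depend on the distance of two cells *)

(** These are partial sums of the series of the moment at the point [u = 0]. *)
Lemma moment_partial_sums (R : realType) (sigma phi : R -> R) :
  admissible_sigmoidal sigma ->
  (moment phi 0 1 (density sigma) < +oo)%E ->
  exists M : R, forall N, \sum_(e < N) density sigma e%:R * phi e%:R <= M.
Proof.
move=> sP mfin; exists (fine (moment phi 0 1 (density sigma))) => N.
pose F k := (density sigma (0 - k%:~R) * `|0 - k%:~R| `^ 0 *
  phi (`|0 - k%:~R| `^ 1) : R)%:E.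
have le_mom : ((\sum_(e < N) density sigma e%:R * phi e%:R)%:E <=
    moment phi 0 1 (density sigma))%E.
  apply: le_trans (_ : \esum_(k in [set: int]) F k <= _)%E; last first.
    by apply: ereal_sup_ubound; exists 0.
  apply: esum_ge; exists (Posz @` `I_N).
    by split => //; exact: finite_image.
  rewrite fsbig_image; last by move=> i j _ _ [].
  rewrite -fsbig_ord -sumEFin; apply: lee_sum => i _.
  rewrite lee_fin sub0r normrN powRr0 mulr1 powRr1//.
  by rewrite (density_even _ sP) ger0_norm ?ler0n.
move: le_mom mfin; case: (moment _ _ _ _) => [r| |]//=.
Qed.

Section kappa.
Variables (R : realType) (sigma phi : R -> R) (C : R).
Hypothesis sigmaP : admissible_sigmoidal sigma.
Hypothesis phiP : phi_function phi.
Hypothesis C0 : 0 < C.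
Hypothesis phiC : forall u v, 0 <= u -> 1 <= v ->
  phi (u * v) <= C * phi u * phi v.

Lemma phi_le u v : 0 <= u -> u <= v -> phi u <= phi v.
Proof.
by move=> u0 uv; apply: phi_ndecr => //; rewrite in_itv/= andbT// (le_trans u0).
Qed.

Lemma phi_ge0 u : 0 <= u -> 0 <= phi u.
Proof. by move=> u0; rewrite -(phi_0 phiP) phi_le. Qed.

(** At distance [e] the kernel is evaluated at points of absolute value at least
    [e - 1], a range where it decreases if [e >= 2]; otherwise it is bounded by
    [1 / 2], and monotonicity of [phi] suffices because [(e + 1) / 2 <= 1]. *)
Definition kappa (e : nat) : R :=
  if (e <= 1)%N then 2^-1
  else C ^+ 2 * phi 2 * (density sigma e.-1%:R * phi e.-1%:R).

Lemma kappa_ge0 e : 0 <= kappa e.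
Proof.
rewrite /kappa; case: ifP => // _; rewrite mulr_ge0//.
  by rewrite mulr_ge0 ?exprn_ge0 ?(ltW C0)// phi_ge0.
by rewrite mulr_ge0 ?density_ge0// phi_ge0.
Qed.

(** For [e >= 2] one has [(e + 1) / 2 <= 2 (e - 1)], so two applications of the
    Delta'-condition separate [u], [2] and [e - 1], of which the last is
    compensated by the decay of the kernel. *)
Lemma kappa_bound e s u : e.-1%:R <= `|s| -> 0 <= u ->
  density sigma s * phi (e.+1%:R / 2 * u) <= kappa e * phi u.
Proof.
move=> es u0; rewrite /kappa; case: leqP => e1.
  apply: ler_pM; rewrite ?density_ge0 ?phi_ge0 ?density_le_half//.
    by rewrite mulr_ge0// divr_ge0.
  rewrite phi_le// ?mulr_ge0 ?divr_ge0// -[leRHS]mul1r ler_wpM2r//.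
  by rewrite ler_pdivrMr// mul1r ler_nat.
have r1 : 1 <= e.-1%:R :> R by rewrite ler1n -subn1 subn_gt0.
have eE : e.+1%:R = e.-1%:R + 2 :> R by rewrite -natrD addn2 prednK// ltnW.
have ds : density sigma s <= density sigma e.-1%:R.
  by rewrite -(density_norm _ sigmaP) density_nincr.
have e2 : 1 <= e.+1%:R / 2 :> R by rewrite eE; lra.
have p2 : phi (e.+1%:R / 2) <= C * phi e.-1%:R * phi 2.
  apply: le_trans (_ : phi (e.-1%:R * 2) <= _); last by apply: phiC; lra.
  by apply: phi_le; rewrite ?eE; lra.
have pu : phi (e.+1%:R / 2 * u) <= C * phi u * phi (e.+1%:R / 2).
  by rewrite mulrC phiC.
have d0 := density_ge0 s sigmaP.
have Cp0 : 0 <= C * phi u by rewrite mulr_ge0 ?(ltW C0)// phi_ge0.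
apply: le_trans (ler_wpM2l d0 pu) _.
apply: le_trans (ler_wpM2l d0 (ler_wpM2l Cp0 p2)) _.
have w0 : 0 <= C * phi u * (C * phi e.-1%:R * phi 2).
  by rewrite mulr_ge0// !mulr_ge0 ?(ltW C0)// ?phi_ge0.
apply: le_trans (ler_wpM2r w0 ds) _.
by rewrite le_eqVlt; apply/orP; left; apply/eqP; ring.
Qed.

Lemma kappa_sum_le M N :
  (forall N, \sum_(e < N) density sigma e%:R * phi e%:R <= M) ->
  \sum_(e < N) kappa e <= 1 + C ^+ 2 * phi 2 * M.
Proof.
move=> HM; apply: le_trans (_ : \sum_(e < N.+2) kappa e <= _).
  rewrite -!(big_mkord xpredT kappa) (@big_cat_nat _ _ _ N _ N.+2)//=.
    by rewrite lerDl sumr_ge0// => i _; exact: kappa_ge0.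
  by rewrite -addn2 leq_addr.
rewrite 2!big_ord_recl/= addrA lerD//.
  by rewrite /kappa/=; lra.
have c0 : 0 <= C ^+ 2 * phi 2.
  by rewrite mulr_ge0 ?exprn_ge0 ?(ltW C0)// phi_ge0.
apply: le_trans (ler_wpM2l c0 (HM N.+1)).
rewrite big_ord_recl/= (phi_0 phiP) mulr0 add0r mulr_sumr.
by apply: ler_sum => i _.
Qed.

End kappa.

(** The mass [nu i] is counted once for each pair [(j, k)] with [i] between [j]
    and [k]; at distance [e] there are at most [e + 1] such pairs on either
    side, which the division by [e + 1] compensates. *)
Lemma sum_between_le (R : realType) (ka nu : nat -> R) (S V : R) N :
  (forall e, 0 <= ka e) -> (forall i, 0 <= nu i) -> 0 <= V ->
  \sum_(e < N) ka e <= S -> (forall K, \sum_(i < K) nu i <= V) ->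
  \sum_(j < N) \sum_(k < N) ka (maxn j k - minn j k)%N /
      (maxn j k - minn j k).+1%:R *
      \sum_(minn j k <= i < (maxn j k).+1) nu i <= 2 * S * V.
Proof.
move=> ka0 nu0 V0 kaS nuV.
pose F j k := ka (maxn j k - minn j k)%N / (maxn j k - minn j k).+1%:R *
      \sum_(minn j k <= i < (maxn j k).+1) nu i.
have F0 j k : 0 <= F j k.
  by rewrite mulr_ge0 ?divr_ge0// big_nat sumr_ge0.
have FC j k : F j k = F k j by rewrite /F maxnC minnC.
have half : \sum_(j < N) \sum_(k < N | (j <= k)%N) F j k <= S * V.
  apply: le_trans (_ : \sum_(j < N) \sum_(e < N) F j (j + e)%N <= _).
    apply: ler_sum => j _; rewrite -(big_geq_mkord _ _ xpredT (F j)).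
    rewrite -{1}[nat_of_ord j]add0n big_addn big_mkord.
    rewrite [leRHS](big_ord_widen _ (fun e => F j (j + e)%N) (leqnn N)).
    rewrite (big_ord_widen N (fun e => F j (e + j)%N)) ?leq_subr//.
    rewrite [leLHS]big_mkcond [leRHS]big_mkcond/=; apply: ler_sum => e _.
    by rewrite ltn_ord addnC; case: ifP.
  rewrite exchange_big/=; apply: le_trans (ler_wpM2r V0 kaS).
  rewrite mulr_suml; apply: ler_sum => e _.
  have FE (j : 'I_N) : F j (j + e)%N =
      ka e / e.+1%:R * \sum_(t < e.+1) nu (t + j)%N.
    rewrite /F (maxn_idPr (leq_addr _ _)) (minn_idPl (leq_addr _ _)) addKn.
    rewrite -[X in \sum_(X <= _ < _) _]add0n big_addn subSn ?leq_addr//.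
    by rewrite addKn big_mkord.
  under eq_bigr do rewrite FE.
  rewrite -mulr_sumr exchange_big/=.
  apply: le_trans (_ : ka e / e.+1%:R * \sum_(t < e.+1) V <= _); last first.
    by rewrite sumr_const card_ord -[V *+ _]mulr_natl mulrA divfK ?pnatr_eq0.
  apply: ler_wpM2l; first by rewrite divr_ge0.
  apply: ler_sum => t _; apply: le_trans (nuV (N + t)%N).
  rewrite -[leRHS](big_mkord xpredT nu).
  have -> : \sum_(0 <= i < N + t) nu i =
      \sum_(0 <= i < t) nu i + \sum_(t <= i < N + t) nu i.
    by apply: big_cat_nat => //; exact: leq_addl.
  rewrite -[X in _ + \sum_(X <= _ < _) _]add0n big_addn addnK big_mkord.
  have -> : \sum_(j < N) nu (t + j)%N = \sum_(j < N) nu (j + t)%N.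
    by apply: eq_bigr => j _; rewrite addnC.
  by rewrite lerDr big_nat sumr_ge0.
have -> : 2 * S * V = S * V + S * V by ring.
apply: le_trans (lerD half half).
rewrite [X in _ <= _ + X](exchange_big_dep xpredT)//= -big_split/=.
apply: ler_sum => j _.
rewrite [X in _ <= X + _]big_mkcond [X in _ <= _ + X]big_mkcond -big_split/=.
apply: ler_sum => k _; rewrite -/(F j k) (FC k j).
by case: (leqP j k) => jk; rewrite ?lerDl ?(ltnW jk) ?add0r//; case: ifP.
Qed.

(** * The grid of the operator *)

(** The grid starts one mesh to the left of the first node [m / n], with
    [m = ceil (n a)], so that its cells of natural index cover [a, b]. *)
Definition grid (R : realType) (n : nat) (m : int) (j : nat) : R :=
  (m%:~R - 1 + j%:R) / n%:R.

Lemma gridB (R : realType) n m j i : (0 < n)%N ->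
  n%:R * (grid R n m j - grid R n m i) = j%:R - i%:R.
Proof.
by move=> n0; rewrite /grid; field; rewrite pnatr_eq0 -lt0n.
Qed.

Lemma grid_le (R : realType) n m i j :
  (i <= j)%N -> grid R n m i <= grid R n m j.
Proof. by move=> ij; rewrite ler_wpM2r ?invr_ge0// lerD2l ler_nat. Qed.

Lemma kantorovich_range_grid (R : realType) (a b : R) n m K :
  Num.ceil (n%:R * a) = m -> Num.floor (n%:R * b) = m + Posz K ->
  kantorovich_range a b n = (fun k : nat => m + Posz k) @` `I_K.
Proof.
move=> am bm; rewrite /kantorovich_range am bm; apply/seteqP; split => k /=.
  move=> /andP[mk kK]; exists `|k - m|%N; first by lia.
  by lia.
by move=> [i iK <-]; lia.
Qed.

Lemma kantorovich_gridE (R : realType) (sigma : R -> R) (a b : R) n m K f x :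
  (0 < n)%N ->
  Num.ceil (n%:R * a) = m -> Num.floor (n%:R * b) = m + Posz K ->
  kantorovich sigma a b n f x =
    (\sum_(k < K) (n%:R * \int[lebesgue_measure]_(u in
         `[grid R n m k.+1, grid R n m k.+2]) f u) *
         density sigma (n%:R * (x - grid R n m k.+1))) /
    \sum_(k < K) density sigma (n%:R * (x - grid R n m k.+1)).
Proof.
move=> n0 am bm; rewrite /kantorovich (kantorovich_range_grid am bm).
have n0' : n%:R != 0 :> R by rewrite pnatr_eq0 -lt0n.
have gE (k : nat) : (m + Posz k)%:~R / n%:R = grid R n m k.+1.
  by rewrite /grid intrD -natr1; congr (_ / _); ring.
have gE1 (k : nat) : (m + Posz k + 1)%:~R / n%:R = grid R n m k.+2.
  by rewrite /grid !intrD -[k.+2%:R]natr1 -natr1; congr (_ / _); ring.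
have dE (k : nat) : n%:R * x - (m + Posz k)%:~R =
    n%:R * (x - grid R n m k.+1).
  by rewrite -gE; field.
have inj : set_inj `I_K (fun k : nat => m + Posz k).
  by move=> i j _ _ /addrI[].
rewrite !fsbig_image// -!fsbig_ord; congr (_ / _).
  by apply: eq_bigr => k _; rewrite gE gE1 dE.
by apply: eq_bigr => k _; rewrite dE.
Qed.

(** The operator averages over the cells with index [1 <= j <= K]; the cells
    with index [0] and [K + 1] contain the ends of [a, b] left over. *)
Lemma grid_cell (R : realType) (a b : R) n m K x : (0 < n)%N ->
  Num.ceil (n%:R * a) = m -> Num.floor (n%:R * b) = m + Posz K ->
  a <= x -> x <= b ->
  exists j : 'I_K.+2, grid R n m j <= x < grid R n m j.+1.
Proof.
move=> n0 am bm ax xb.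
have n0' : 0 < n%:R :> R by rewrite ltr0n.
have nx0 : m%:~R - 1 <= n%:R * x.
  apply: le_trans (_ : n%:R * a <= _); last by rewrite ler_pM2l.
  by apply/ltW; have := ceil_itv (n%:R * a); rewrite am intrB => /andP[].
have nx1 : n%:R * x < m%:~R + K%:R + 1.
  apply: le_lt_trans (_ : n%:R * b < _); first by rewrite ler_pM2l.
  by have := floor_itv (n%:R * b); rewrite bm !intrD => /andP[].
pose z := n%:R * x - (m%:~R - 1).
have z0 : 0 <= z by rewrite subr_ge0.
have /andP[z1 z2] := truncn_itv z0.
have zK : (Num.truncn z < K.+2)%N.
  rewrite -(ltr_nat R) -addn2 natrD; apply: le_lt_trans z1 _.
  by rewrite /z; lra.
exists (Ordinal zK); rewrite /grid /= ler_pdivrMr// ltr_pdivlMr// mulrC.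
by rewrite /z in z1 z2 *; apply/andP; split; lra.
Qed.

Lemma grid_within (R : realType) (a b : R) n m K k : (0 < n)%N ->
  Num.ceil (n%:R * a) = m -> Num.floor (n%:R * b) = m + Posz K ->
  (k < K)%N -> a <= grid R n m k.+1 /\ grid R n m k.+2 <= b.
Proof.
move=> n0 am bm kK; have n0' : 0 < n%:R :> R by rewrite ltr0n.
rewrite /grid ler_pdivlMr// ler_pdivrMr// ![_ * n%:R]mulrC; split.
  have := ceil_ge (n%:R * a); rewrite am => /le_trans; apply.
  by rewrite -natr1; have := ler0n R k; lra.
have := floor_itv (n%:R * b); rewrite bm => /andP[+ _]; apply: le_trans.
rewrite intrD -[k.+2%:R]natr1.
have : k.+1%:R <= K%:R :> R by rewrite ler_nat.
by rewrite -[(Posz K)%:~R]/(K%:R : R); lra.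
Qed.

(** The factor [d], to be a value of the kernel, enters the pointwise
    hypothesis, because only its product with [f (l * u x)] has a good
    bound. *)
Lemma weighted_jensen_integral (R : realType) (f : R -> R)
    (E : set (measurableTypeR R)) (d l : R) (u h : R -> R) :
  convex_function (`[0, +oo[%classic : set R) f ->
  {in `[0, +oo[ &, {homo f : x y / x <= y}} -> f 0 = 0 ->
  measurable E -> (lebesgue_measure E <= l%:E)%E -> 0 <= l -> 0 <= d ->
  lebesgue_measure.-integrable E (EFin \o u) ->
  lebesgue_measure.-integrable E (EFin \o h) ->
  (forall x, 0 <= u x) -> (forall x, 0 <= h x) ->
  (forall x, E x -> d * f (l * u x) <= h x) ->
  d * (l * f (\int[lebesgue_measure]_(x in E) u x)) <=
    \int[lebesgue_measure]_(x in E) h x.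
Proof.
move=> cf ndf f0 mE El l0; rewrite le_eqVlt => /predU1P[<-|d0] iu ih u0 h0 fh.
  by rewrite mul0r; apply: Rintegral_ge0.
have ih' : lebesgue_measure.-integrable E (EFin \o (fun x => d^-1 * h x)).
  rewrite (_ : _ \o _ = (fun x => (d^-1)%:E * (EFin \o h) x)%E)//.
  exact: integrableZl.
rewrite -ler_pdivlMl// -RintegralZl//.
apply: (convex_jensen_integral cf ndf f0 mE El l0 iu ih' u0) => x Ex.
by rewrite ler_pdivlMl//; exact: fh.
Qed.

Section integral_itv.
Variables (R : realType) (q : R -> R).
Hypothesis iq : lebesgue_measure.-integrable [set: R] (EFin \o q).
Hypothesis q0 : forall t, 0 <= q t.
Let I (s t : R) := \int[lebesgue_measure]_(y in `[s, t]) q y.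
Let W (t : R) := \int[lebesgue_measure]_(y in `]-oo, t]) q y.

Lemma integrable_itv (i : interval R) :
  lebesgue_measure.-integrable [set` i] (EFin \o q).
Proof. by apply: integrableS iq. Qed.

Let IE s t : s <= t -> I s t = W t - W s.
Proof.
move=> st; rewrite /W Rintegral_itvB ?bnd_simp//; last exact: integrable_itv.
by rewrite Rintegral_itv_obnd_cbnd//; exact: integrable_itv.
Qed.

Lemma sum_integral_grid n m i k : (i <= k)%N ->
  \sum_(i <= j < k) I (grid R n m j) (grid R n m j.+1) =
  I (grid R n m i) (grid R n m k).
Proof.
move=> ik; under eq_bigr do rewrite IE ?grid_le//.
by rewrite (telescope_sumr (fun j => W (grid R n m j)))// IE// grid_le.
Qed.

Lemma Rintegral_le_set (A B : set (measurableTypeR R)) : measurable A ->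
  measurable B -> A `<=` B ->
  \int[lebesgue_measure]_(y in A) q y <= \int[lebesgue_measure]_(y in B) q y.
Proof.
move=> mA mB AB; apply: fine_le.
- by apply: integrable_fin_num => //; apply: integrableS iq.
- by apply: integrable_fin_num => //; apply: integrableS iq.
apply: ge0_subset_integral => //.
  by have /integrableP[+ _] := iq; exact: measurable_funS.
by move=> x _; rewrite lee_fin.
Qed.

Lemma sum_integral_grid_le n m k :
  \sum_(j < k) I (grid R n m j) (grid R n m j.+1) <=
  \int[lebesgue_measure]_y q y.
Proof.
rewrite -(big_mkord xpredT (fun j => I (grid R n m j) (grid R n m j.+1))).
by rewrite sum_integral_grid//; exact: Rintegral_le_set.
Qed.

End integral_itv.

(** * One pair of cells *)

Lemma mean_dist_le (R : realType) (s t : R) (f : R -> R) (y D : R) : s < t ->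
  lebesgue_measure.-integrable `[s, t] (EFin \o f) ->
  (forall u, s <= u -> u <= t -> `|f u - y| <= D) ->
  `|(t - s)^-1 * (\int[lebesgue_measure]_(u in `[s, t]) f u) - y| <= D.
Proof.
move=> st fi fD; have ts : 0 < t - s by rewrite subr_gt0.
pose I : set (measurableTypeR R) := `[s, t]%classic.
have mI : measurable I by exact: measurable_itv.
have muI : lebesgue_measure I = (t - s)%:E.
  by rewrite /I lebesgue_measure_itv/= lte_fin st EFinB.
have If : lebesgue_measure I \is a fin_num by rewrite muI.
have cst_int k : \int[lebesgue_measure]_(u in I) cst k u = k * (t - s).
  by rewrite finite_Rintegral_cst// muI.
have ub : \int[lebesgue_measure]_(u in I) f u <= (y + D) * (t - s).
  rewrite -cst_int; apply: le_Rintegral => //.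
    exact: (finite_integrable_cst (y + D) mI If).
  move=> u; rewrite /I/= in_itv/= => /andP[su ut].
  by have := le_trans (ler_norm _) (fD u su ut); lra.
have lb : (y - D) * (t - s) <= \int[lebesgue_measure]_(u in I) f u.
  rewrite -cst_int; apply: le_Rintegral => //.
    exact: (finite_integrable_cst (y - D) mI If).
  move=> u; rewrite /I/= in_itv/= => /andP[su ut].
  by have := fD u su ut; rewrite ler_norml => /andP[]; lra.
rewrite -ler_pdivrMr// mulrC in ub *; rewrite -ler_pdivlMr// mulrC in lb.
rewrite ler_norml; apply/andP; split; move: ub lb; rewrite -/I; lra.
Qed.

Section pair.
Variables (R : realType) (sigma phi : R -> R) (C : R).
Hypothesis sigmaP : admissible_sigmoidal sigma.
Hypothesis phiP : phi_function phi.
Hypothesis phi_convex : convex_function (`[0, +oo[%classic : set R) phi.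
Hypothesis C0 : 0 < C.
Hypothesis phiC : forall u v, 0 <= u -> 1 <= v ->
  phi (u * v) <= C * phi u * phi v.
Variables (n : nat) (m : int) (lambda : R) (p : R -> R).
Hypothesis n0 : (0 < n)%N.
Hypothesis lambda0 : 0 < lambda.
Hypothesis ip : lebesgue_measure.-integrable [set: R] (EFin \o p).
Hypothesis p0 : forall t, 0 <= p t.
Let q t := phi (2 * lambda / n%:R * p t).
Hypothesis iq : lebesgue_measure.-integrable [set: R] (EFin \o q).

Definition hull_integral (j k : nat) (r : R -> R) : R :=
  \int[lebesgue_measure]_(t in
    `[grid R n m (minn j k), grid R n m (maxn j k).+1]) r t.

(** The mean of [q] over the hull, of length [(e + 1) / n], times the weight,
    with the integral over the hull split into cells. *)
Definition pair_bound (j k : nat) : R :=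
  n%:R * (kappa sigma phi C (maxn j k - minn j k) /
    (maxn j k - minn j k).+1%:R *
    \sum_(minn j k <= i < (maxn j k).+1)
      \int[lebesgue_measure]_(t in `[grid R n m i, grid R n m i.+1]) q t).

(** [p] will be [|f'|] cut off outside [a, b]. The argument of [phi] under the
    integral is [(e + 1) / n * lambda * p = (e + 1) / 2 * (2 * lambda / n * p)],
    where the factor [(e + 1) / 2] is absorbed by the kernel. *)
Lemma weighted_hull_integral_le j k x :
  grid R n m j <= x < grid R n m j.+1 ->
  density sigma (n%:R * (x - grid R n m k)) *
    phi (lambda * hull_integral j k p) <=
  pair_bound j k.
Proof.
move=> xj; rewrite /pair_bound; have n0' : 0 < n%:R :> R by rewrite ltr0n.
set e := (maxn j k - minn j k)%N; set d := density _ _.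
have minmax : (minn j k <= maxn j k)%N by rewrite geq_min leq_maxl.
have q0 t : 0 <= q t.
  by apply: (phi_ge0 phiP); rewrite mulr_ge0// divr_ge0// mulr_ge0// ltW.
have ndphi : {in `[0, +oo[ &, {homo phi : x y / x <= y}} := phi_ndecr phiP.
pose E : set (measurableTypeR R) :=
  `[grid R n m (minn j k), grid R n m (maxn j k).+1]%classic.
have mE : measurable E by exact: measurable_itv.
have lenE : grid R n m (maxn j k).+1 - grid R n m (minn j k) = e.+1%:R / n%:R.
  rewrite /grid -mulrBl; congr (_ / _).
  rewrite -[(maxn j k).+1%:R]natr1 -[e.+1%:R]natr1 /e natrB//; ring.
have El : (lebesgue_measure E <= (e.+1%:R / n%:R)%:E)%E.
  rewrite /E lebesgue_measure_itv/= lte_fin -lenE; case: ifP => //= _.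
  by rewrite lee_fin subr_ge0 grid_le// ltnW.
have l0 : 0 <= e.+1%:R / n%:R :> R by rewrite divr_ge0.
have ip' : lebesgue_measure.-integrable E (EFin \o p) by apply: integrableS ip.
have iq' : lebesgue_measure.-integrable E (EFin \o q) by apply: integrableS iq.
have iu : lebesgue_measure.-integrable E (EFin \o (fun t => lambda * p t)).
  rewrite (_ : _ \o _ = (fun x => lambda%:E * (EFin \o p) x)%E)//.
  exact: integrableZl.
pose ka := kappa sigma phi C e.
have ih : lebesgue_measure.-integrable E (EFin \o (fun t => ka * q t)).
  rewrite (_ : _ \o _ = (fun x => ka%:E * (EFin \o q) x)%E)//.
  exact: integrableZl.
have dist : e.-1%:R <= `|n%:R * (x - grid R n m k)|.
  have /andP[x1 x2] := xj.
  have := gridB R m j k n0; have := gridB R m j.+1 k n0.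
  have : n%:R * grid R n m j <= n%:R * x by rewrite ler_pM2l.
  have : n%:R * x < n%:R * grid R n m j.+1 by rewrite ltr_pM2l.
  rewrite !mulrBr; set X := n%:R * x; set Y := n%:R * grid _ _ _ k.
  rewrite -natr1 => h1 h2 h3 h4.
  rewrite /e; case: (leqP j k) => jk.
    have [->|jk'] := eqVneq j k; first by rewrite subnn.
    have -> : (k - j).-1%:R = k%:R - j%:R - 1 :> R.
      by rewrite -subn1 !natrB ?subn_gt0// ltn_neqAle jk' jk.
    by rewrite -normrN; apply: le_trans (ler_norm _); lra.
  have -> : (j - k).-1%:R = j%:R - k%:R - 1 :> R.
    by rewrite -subn1 !natrB ?subn_gt0// ltnW.
  by apply: le_trans (ler_norm _); lra.
have ka0 : 0 <= ka by exact: kappa_ge0.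
have H : d * (e.+1%:R / n%:R * phi (lambda * hull_integral j k p)) <=
    ka * hull_integral j k q.
  rewrite /hull_integral -/E -!RintegralZl//.
  apply: (weighted_jensen_integral phi_convex ndphi (phi_0 phiP) mE El l0
    (density_ge0 _ sigmaP) iu ih) => t; first by rewrite mulr_ge0// ltW.
    by rewrite mulr_ge0.
  move=> _; rewrite (_ : e.+1%:R / n%:R * _ =
      e.+1%:R / 2 * (2 * lambda / n%:R * p t)).
    apply: (kappa_bound sigmaP phiP C0 phiC dist).
    by rewrite mulr_ge0// divr_ge0// mulr_ge0// ltW.
  by field; rewrite gt_eqF.
rewrite (sum_integral_grid iq); last exact: leq_trans minmax (leqnSn _).
rewrite -/(hull_integral j k q) -/ka.
have -> : n%:R * (ka / e.+1%:R * hull_integral j k q) =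
    n%:R / e.+1%:R * (ka * hull_integral j k q).
  by field; rewrite addr_eq0 gt_eqF.
have -> : d * phi (lambda * hull_integral j k p) = n%:R / e.+1%:R *
    (d * (e.+1%:R / n%:R * phi (lambda * hull_integral j k p))).
  by field; rewrite gt_eqF//=.
by apply: ler_wpM2l => //; rewrite divr_ge0.
Qed.

End pair.

(** * The pointwise estimate *)

(** Some node is at distance at most [2] from [n x], in units of the mesh: the
    node of the cell of [x] itself, or the nearest one if [x] lies in one of the
    two outer cells. *)
Lemma density_sum_ge (R : realType) (sigma : R -> R) n m K (j : 'I_K.+2) x :
  admissible_sigmoidal sigma -> (0 < n)%N -> (0 < K)%N ->
  grid R n m j <= x < grid R n m j.+1 ->
  density_min sigma <=
    \sum_(k < K) density sigma (n%:R * (x - grid R n m k.+1)).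
Proof.
move=> sP n0 K0 /andP[x1 x2]; have n0' : 0 < n%:R :> R by rewrite ltr0n.
have jK := ltn_ord j.
have kK : ((minn K (maxn 1 j)).-1 < K)%N by lia.
rewrite (bigD1 (Ordinal kK))//= -[leLHS]addr0; apply: lerD; last first.
  by apply: sumr_ge0 => k _; exact: density_ge0.
apply: density_min_le => //.
have kE : ((minn K (maxn 1 j)).-1.+1 = minn K (maxn 1 j))%N by lia.
rewrite kE; set k := minn K (maxn 1 j).
have := gridB R m j k n0; have := gridB R m j.+1 k n0.
have : n%:R * grid R n m j <= n%:R * x by rewrite ler_pM2l.
have : n%:R * x < n%:R * grid R n m j.+1 by rewrite ltr_pM2l.
rewrite !mulrBr; set X := n%:R * x; set Y := n%:R * grid _ _ _ k.
have k1 : k%:R <= j%:R + 1 :> R by rewrite natr1 ler_nat /k; lia.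
have k2 : j%:R <= k%:R + 1 :> R by rewrite natr1 ler_nat /k; lia.
by rewrite -natr1 => ? ? ? ?; rewrite ler_norml; apply/andP; split; lra.
Qed.

Section pointwise.
Variables (R : realType) (sigma phi : R -> R) (C : R).
Hypothesis sigmaP : admissible_sigmoidal sigma.
Hypothesis phiP : phi_function phi.
Hypothesis phi_convex : convex_function (`[0, +oo[%classic : set R) phi.
Hypothesis C0 : 0 < C.
Hypothesis phiC : forall u v, 0 <= u -> 1 <= v ->
  phi (u * v) <= C * phi u * phi v.
Variables (a b : R) (n : nat) (m : int) (K : nat) (lambda : R) (p f : R -> R).
Hypothesis n0 : (0 < n)%N.
Hypothesis K0 : (0 < K)%N.
Hypothesis am : Num.ceil (n%:R * a) = m.
Hypothesis bm : Num.floor (n%:R * b) = m + Posz K.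
Hypothesis lambda0 : 0 < lambda.
Hypothesis ip : lebesgue_measure.-integrable [set: R] (EFin \o p).
Hypothesis p0 : forall t, 0 <= p t.
Let q t := phi (2 * lambda / n%:R * p t).
Hypothesis iq : lebesgue_measure.-integrable [set: R] (EFin \o q).
Hypothesis fi : forall s t, a <= s -> t <= b ->
  lebesgue_measure.-integrable `[s, t] (EFin \o f).
Hypothesis fp : forall s t, a <= s -> s <= t -> t <= b ->
  `|f t - f s| <= \int[lebesgue_measure]_(y in `[s, t]) p y.

Lemma dist_le_hull j k u v : a <= u -> u <= b -> a <= v -> v <= b ->
  grid R n m j <= u <= grid R n m j.+1 ->
  grid R n m k <= v <= grid R n m k.+1 ->
  `|f v - f u| <= hull_integral n m j k p.
Proof.
move=> au ub av vb /andP[ju uj] /andP[kv vk].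
have sub s t : grid R n m (minn j k) <= s -> t <= grid R n m (maxn j k).+1 ->
    \int[lebesgue_measure]_(y in `[s, t]) p y <= hull_integral n m j k p.
  move=> s1 t1; apply: Rintegral_le_set => //.
  by apply: subset_itv; rewrite bnd_simp.
have [uv|/ltW vu] := leP u v.
  apply: le_trans (fp au uv vb) _; apply: sub.
    by apply: le_trans ju; rewrite grid_le// geq_minl.
  by apply: le_trans vk _; rewrite grid_le// ltnS leq_maxr.
rewrite distrC; apply: le_trans (fp av vu ub) _; apply: sub.
  by apply: le_trans kv; rewrite grid_le// geq_minr.
by apply: le_trans uj _; rewrite grid_le// ltnS leq_maxl.
Qed.

Lemma kantorovich_pointwise (j : 'I_K.+2) x : a <= x -> x <= b ->
  grid R n m j <= x < grid R n m j.+1 ->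
  phi (lambda * `|kantorovich sigma a b n f x - f x|) <=
  (density_min sigma)^-1 * \sum_(k < K.+2)
    pair_bound sigma phi C n m lambda p j k.
Proof.
move=> ax xb xj; have n0' : 0 < n%:R :> R by rewrite ltr0n.
have q0 t : 0 <= q t.
  by apply: (phi_ge0 phiP); rewrite mulr_ge0// divr_ge0// mulr_ge0// ltW.
have T0 k : 0 <= pair_bound sigma phi C n m lambda p j k.
  rewrite /pair_bound mulr_ge0// mulr_ge0//.
    by apply: divr_ge0 => //; exact: (kappa_ge0 sigmaP phiP C0).
  rewrite big_nat sumr_ge0// => i _; apply: Rintegral_ge0 => t _.
  exact: q0.
have := density_sum_ge sigmaP n0 K0 xj.
pose w (k : 'I_K) := density sigma (n%:R * (x - grid R n m k.+1)).
have w0 k : 0 <= w k by exact: density_ge0.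
rewrite -/(\sum_(k < K) w k); set c := density_min sigma; set Z := \sum_k w k.
move=> cZ; have c0 : 0 < c by exact: density_min_gt0.
have Z0 : 0 < Z by exact: lt_le_trans cZ.
pose D k := hull_integral n m j k p.
have D0 k : 0 <= D k by apply: Rintegral_ge0.
pose A (k : 'I_K) := n%:R *
  \int[lebesgue_measure]_(u in `[grid R n m k.+1, grid R n m k.+2]) f u.
have AD k : `|A k - f x| <= D k.+1.
  have [ak kb] := grid_within n0 am bm (ltn_ord k).
  have kE : n%:R * (grid R n m k.+2 - grid R n m k.+1) = 1.
    by rewrite gridB// -[k.+2%:R]natr1; ring.
  have kk : grid R n m k.+1 < grid R n m k.+2.
    by rewrite -subr_gt0 -(pmulr_rgt0 _ n0') kE.
  have nE : n%:R = (grid R n m k.+2 - grid R n m k.+1)^-1 :> R.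
    have h0 : grid R n m k.+2 - grid R n m k.+1 != 0.
      by rewrite gt_eqF// subr_gt0.
    by rewrite -[LHS](mulfK h0) kE mul1r.
  rewrite /A nE; apply: mean_dist_le => //; first exact: fi.
  move=> u ku uk; apply: dist_le_hull => //.
  - exact: le_trans ku.
  - exact: le_trans kb.
  - by case/andP: xj => -> /ltW ->.
  - by rewrite ku uk.
have KE : kantorovich sigma a b n f x - f x =
    \sum_(k < K) w k / Z * (A k - f x).
  rewrite (kantorovich_gridE _ _ _ n0 am bm) -/(\sum_(k < K) w k) -/Z.
  under [RHS]eq_bigr do rewrite mulrBr.
  rewrite sumrB -mulr_suml -mulr_suml divff ?gt_eqF// mul1r; congr (_ - _).
  by rewrite mulr_suml; apply: eq_bigr => k _; rewrite [X in X / _]mulrC mulrAC.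
have wZ0 k : 0 <= w k / Z by rewrite divr_ge0// ltW.
have dist : lambda * `|kantorovich sigma a b n f x - f x| <=
    \sum_(k < K) w k / Z * (lambda * D k.+1).
  under eq_bigr do rewrite mulrCA.
  rewrite -mulr_sumr ler_pM2l// KE; apply: le_trans (ler_norm_sum _ _ _) _.
  by apply: ler_sum => k _; rewrite normrM ger0_norm// ler_wpM2l.
apply: le_trans (phi_le phiP _ dist) _; first by rewrite mulr_ge0// ltW.
apply: le_trans (convex_jensen_sum phi_convex (phi_ndecr phiP) wZ0 _ _) _.
- by move=> k; rewrite mulr_ge0// ltW.
- by rewrite -mulr_suml divff// gt_eqF.
under eq_bigr do rewrite mulrAC mulrC.
rewrite -mulr_sumr; apply: ler_pM.
- by rewrite invr_ge0 ltW.
- apply: sumr_ge0 => k _; rewrite mulr_ge0// (phi_ge0 phiP)// mulr_ge0//.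
  exact: ltW.
- by rewrite lef_pV2.
(* The cells of index [0] and [K + 1] are added to the sum over nodes. *)
rewrite big_ord_recl/= big_ord_recr/= addrCA -[leLHS]addr0; apply: lerD.
  apply: ler_sum => k _.
  exact: (weighted_hull_integral_le sigmaP phiP phi_convex C0 phiC n0 lambda0
    ip p0 iq _ xj).
by rewrite addr_ge0.
Qed.

End pointwise.

(** * Integration over the interval *)

(** The integral of a nonnegative function is a supremum over simple functions,
    hence monotone for all functions, measurable or not. *)
Lemma ge0_integral_mono (R : realType) (D : set R) (f g : R -> \bar R) :
  (forall x, D x -> 0 <= f x)%E -> (forall x, D x -> f x <= g x)%E ->
  (\int[lebesgue_measure]_(x in D) f x <=
   \int[lebesgue_measure]_(x in D) g x)%E.
Proof.
move=> f0 fg; rewrite integral_mkcond [leRHS]integral_mkcond.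
rewrite !ge0_integralTE; last 2 first.
- move=> x; rewrite patchE; case: ifPn => // /set_mem Dx.
  exact: le_trans (f0 _ Dx) (fg _ Dx).
- by move=> x; rewrite patchE; case: ifPn => // /set_mem Dx; exact: f0.
apply: ereal_sup_le => _ [h hf <-]; exists h => // x.
apply: le_trans (hf x) _; rewrite !patchE; case: ifPn => // /set_mem Dx.
exact: fg.
Qed.

Lemma step_integral_le (R : realType) (a b : R) n m N (h : R -> R)
    (c : 'I_N -> R) : (0 < n)%N -> (forall j, 0 <= c j) ->
  (forall x, a <= x -> x <= b -> 0 <= h x) ->
  (forall x, a <= x -> x <= b ->
    exists j : 'I_N, grid R n m j <= x < grid R n m j.+1) ->
  (forall (j : 'I_N) x, a <= x -> x <= b ->
    grid R n m j <= x < grid R n m j.+1 -> h x <= c j) ->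
  (\int[lebesgue_measure]_(x in `[a, b]) (h x)%:E <=
   (\sum_(j < N) c j / n%:R)%:E)%E.
Proof.
move=> n0 c0 h0 cover hc; have n0' : 0 < n%:R :> R by rewrite ltr0n.
pose J (j : 'I_N) : set (measurableTypeR R) :=
  `[grid R n m j, grid R n m j.+1[%classic.
have mJ j : measurable (J j) by exact: measurable_itv.
have muJ j : lebesgue_measure (J j) = (n%:R^-1)%:E.
  have gE : grid R n m j.+1 - grid R n m j = n%:R^-1.
    have nN0 : n%:R != 0 :> R by rewrite gt_eqF.
    by apply: (mulfI nN0); rewrite gridB// divff// -natr1; ring.
  rewrite /J lebesgue_measure_itv/= lte_fin -subr_gt0 gE invr_gt0 n0'.
  by rewrite -EFinB gE.
have ind0 j x : (0 <= (c j)%:E * (\1_(J j) x)%:E)%E.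
  by rewrite -EFinM lee_fin mulr_ge0.
have mind (D : set (measurableTypeR R)) j :
    measurable_fun D (fun x => (c j)%:E * (\1_(J j) x)%:E)%E.
  apply/measurable_EFinP; exact: measurable_funM.
apply: le_trans (_ : \int[lebesgue_measure]_(x in `[a, b])
    (\sum_(j < N) (c j)%:E * (\1_(J j) x)%:E) <= _)%E.
  apply: ge0_integral_mono => x /=; rewrite in_itv/= => /andP[ax xb].
    by rewrite lee_fin h0.
  have [j xj] := cover x ax xb.
  rewrite (bigD1 j)//= indicE mem_set /J/= ?in_itv//= mule1.
  rewrite -[leLHS]adde0; apply: leeD; first by rewrite lee_fin (hc j).
  by apply: sume_ge0 => i _; exact: ind0.
rewrite ge0_integral_sum//.
rewrite -sumEFin; apply: lee_sum => j _.
rewrite ge0_integralZl//; last 2 first.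
- exact/measurable_EFinP.
- by rewrite lee_fin.
rewrite integral_indic//.
rewrite EFinM lee_wpmul2l ?lee_fin// -(muJ j).
by apply: le_measure; rewrite ?inE//; exact: measurableI.
Qed.

Lemma phi_scale_measurable (R : realType) (phi : R -> R)
    (D : set (measurableTypeR R)) (c : R) (p : R -> R) :
  phi_function phi -> 0 <= c -> (forall t, 0 <= p t) ->
  measurable D -> measurable_fun D p ->
  measurable_fun D (fun t => phi (c * p t)).
Proof.
move=> phiP c0 p0 mD mp.
have -> : (fun t => phi (c * p t)) =
    (fun u => phi (Num.max 0 u)) \o (fun t => c * p t).
  by apply/funext => t /=; rewrite (max_idPr _)// mulr_ge0.
apply: measurableT_comp; last exact: measurable_funM.
apply: nondecreasing_measurable => // u v uv.
by apply: (phi_le phiP); [rewrite le_max lexx|exact: le_max2].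
Qed.

(** The constant depends on [phi] and [sigma] only, through a bound [S] of the
    sums of the weights. *)
Lemma modular_kantorovich_le (R : realType) (a b : R) (sigma phi : R -> R)
    (C S : R) (f : R -> R) (lambda : R) (n : nat) :
  a < b -> admissible_sigmoidal sigma -> phi_function phi ->
  convex_function (`[0, +oo[%classic : set R) phi -> 0 < C ->
  (forall u v, 0 <= u -> 1 <= v -> phi (u * v) <= C * phi u * phi v) ->
  (forall N, \sum_(e < N) kappa sigma phi C e <= S) ->
  absolutely_continuous a b f -> measurable_fun `[a, b] f^`()%classic ->
  0 < lambda -> Num.ceil (n%:R * a) <= Num.floor (n%:R * b) - 1 ->
  (modular phi a b (fun x => lambda * (kantorovich sigma a b n f x - f x))%R <=
   (2 * S / density_min sigma)%:E *
   modular phi a b (fun x => 2 * lambda / n%:R * f^`()%classic x)%R)%E.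
Proof.
move=> ab sP phiP cphi C0 phiC kaS acf mf' l0 hn.
have n0 : (0 < n)%N.
  by case: n hn => // ; rewrite !mul0r ceil0 floor0.
have n0' : 0 < n%:R :> R by rewrite ltr0n.
pose m := Num.ceil (n%:R * a).
pose K := `|Num.floor (n%:R * b) - m|%N.
have K0 : (0 < K)%N by rewrite /K /m; lia.
have am : Num.ceil (n%:R * a) = m by [].
have bm : Num.floor (n%:R * b) = m + Posz K by rewrite /K /m; lia.
pose c := 2 * lambda / n%:R.
have c0 : 0 < c by rewrite divr_gt0// mulr_gt0.
have ndphi : {in `[0, +oo[ &, {homo phi : x y / x <= y}} := phi_ndecr phiP.
have [if' incr] := absolutely_continuous_derive_integrable ab acf mf'.
pose I : set (measurableTypeR R) := `[a, b]%classic.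
have mI : measurable I by exact: measurable_itv.
pose p : R -> R := (fun t => `|f^`()%classic t|) \_ I.
have p0 t : 0 <= p t by rewrite /p patchE; case: ifP.
have ip : lebesgue_measure.-integrable [set: R] (EFin \o p).
  rewrite /p -restrict_EFin -integrable_mkcond//.
  exact: integrable_norm if'.
pose q t := phi (c * p t).
have q0 t : 0 <= q t by rewrite (phi_ge0 phiP)// mulr_ge0// ltW.
have mq : measurable_fun [set: R] q.
  apply: phi_scale_measurable => //; first exact: ltW.
  by have /integrableP[/measurable_EFinP] := ip.
have modE : modular phi a b (fun x => c * f^`()%classic x) =
    (\int[lebesgue_measure]_t (q t)%:E)%E.
  rewrite /modular integral_mkcond; apply: eq_integral => t _.
  rewrite /q /p !patchE; case: ifP => _; last by rewrite mulr0 (phi_0 phiP).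
  by rewrite normrM (gtr0_norm c0).
have S0 : 0 < S.
  by apply: lt_le_trans (kaS 1%N); rewrite big_ord_recl big_ord0 addr0 /kappa/=.
have cst0 : 0 < 2 * S / density_min sigma.
  by rewrite divr_gt0 ?density_min_gt0// mulr_gt0.
rewrite -/c modE.
have [Vfin|] := ltP (\int[lebesgue_measure]_t (q t)%:E)%E +oo%E; last first.
  by rewrite leye_eq => /eqP ->; rewrite gt0_muley ?lte_fin// leey.
have iq : lebesgue_measure.-integrable [set: R] (EFin \o q).
  apply/integrableP; split; first exact/measurable_EFinP.
  by under eq_integral do rewrite gee0_abs ?lee_fin//.
pose V := \int[lebesgue_measure]_t q t.
have VE : (\int[lebesgue_measure]_t (q t)%:E)%E = V%:E.
  by rewrite fineK// ge0_fin_numE// integral_ge0// => t _; rewrite lee_fin.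
rewrite VE -EFinM.
have fcont := chain_ac_clamp_continuous (ltW ab)
  (absolutely_continuous_chain acf).
have fi s t : a <= s -> t <= b ->
    lebesgue_measure.-integrable `[s, t] (EFin \o f).
  move=> sa tb.
  have fci : lebesgue_measure.-integrable `[s, t]
      (EFin \o (f \o clamp a b)).
    apply: continuous_compact_integrable; first exact: segment_compact.
    exact: continuous_subspaceT.
  apply: eq_integrable fci => // u; rewrite inE/= in_itv/= => /andP[su ut].
  by rewrite clamp_id// ?(le_trans sa su)// (le_trans ut tb).
have fp s t : a <= s -> s <= t -> t <= b ->
    `|f t - f s| <= \int[lebesgue_measure]_(y in `[s, t]) p y.
  move=> sa st tb; apply: le_trans (incr s t sa st tb) _.
  rewrite le_eqVlt; apply/orP; left; apply/eqP; apply: eq_Rintegral => y.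
  rewrite inE/= in_itv/= => /andP[sy yt]; rewrite /p patchE mem_set//.
  by rewrite /I/= in_itv/= (le_trans sa sy) (le_trans yt tb).
pose T (j : 'I_K.+2) := (density_min sigma)^-1 *
  \sum_(k < K.+2) pair_bound sigma phi C n m lambda p j k.
have nu0 i : 0 <= \int[lebesgue_measure]_(t in
    `[grid R n m i, grid R n m i.+1]) q t.
  by apply: Rintegral_ge0 => t _.
have pair0 (j k : 'I_K.+2) : 0 <= pair_bound sigma phi C n m lambda p j k.
  rewrite /pair_bound mulr_ge0// mulr_ge0//.
    by apply: divr_ge0 => //; exact: (kappa_ge0 sP phiP C0).
  by rewrite big_nat sumr_ge0// => i _; exact: nu0.
have T0 j : 0 <= T j.
  by rewrite /T mulr_ge0 ?sumr_ge0// invr_ge0 ltW// density_min_gt0.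
apply: le_trans (_ : (\sum_(j < K.+2) T j / n%:R)%:E <= _)%E.
  rewrite /modular; apply: (step_integral_le n0 T0).
  - by move=> x _ _; rewrite (phi_ge0 phiP).
  - by move=> x ax xb; exact: grid_cell am bm ax xb.
  - move=> j x ax xb xj; rewrite normrM (gtr0_norm l0).
    exact: (kantorovich_pointwise sP phiP cphi C0 phiC n0 K0 am bm l0 ip p0
      iq fi fp ax xb xj).
rewrite lee_fin.
have V0 : 0 <= V by apply: Rintegral_ge0.
have := @sum_between_le R (kappa sigma phi C)
  (fun i => \int[lebesgue_measure]_(t in `[grid R n m i, grid R n m i.+1]) q t)
  S V K.+2 (kappa_ge0 sP phiP C0) nu0 V0 (kaS _)
  (sum_integral_grid_le iq q0 n m).
set X := \sum_(j < K.+2) _ => XSV.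
have -> : \sum_(j < K.+2) T j / n%:R = (density_min sigma)^-1 * X.
  rewrite /X mulr_sumr; apply: eq_bigr => j _; rewrite /T -mulrA; congr (_ * _).
  rewrite mulr_suml; apply: eq_bigr => k _; rewrite /pair_bound.
  by rewrite mulrAC divff ?gt_eqF// mul1r.
rewrite mulrAC [leRHS]mulrC ler_wpM2l// invr_ge0 ltW// density_min_gt0//.
Qed.

Theorem theorem4p9 (R : realType) (a b : R) (ab : a < b)
    (sigma : R -> R) (sigmaP : admissible_sigmoidal sigma)
    (phi : R -> R) (phiP : phi_function phi)
    (phi_convex : convex_function (`[0, +oo[%classic : set R) phi)
    (phi_Delta' : Delta' phi)
    (beta : R) (beta_gt1 : 1 < beta)
    (phi_incr : {in `]0, +oo[ &, {homo (fun u => u `^ (- beta) * phi u) :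
                   u v / u <= v}})
    (phi_moment : (moment phi 0 1 (density sigma) < +oo)%E)
    (psi : R -> R) (psiP : phi_function psi)
    (psi_convex : convex_function (`[0, +oo[%classic : set R)
                    (fun x => psi x `^ beta^-1))
    (L : R) (L_ge1 : 1 <= L)
    (phi_psi : forall t : R, 0 <= t -> psi (t / L) <= phi t <= psi (L * t)) :
  exists2 C : R, 0 < C &
    forall f : R -> R, sobolev_orlicz phi a b f ->
    forall lambda : R, 0 < lambda ->
    forall n : nat, Num.ceil (n%:R * a) <= Num.floor (n%:R * b) - 1 ->
      (modular phi a b (fun x => lambda * (kantorovich sigma a b n f x - f x))%R
       <= C%:E *
          modular phi a b (fun x => 2 * L ^+ 2 * lambda / n%:R * f^`()%classic x)%R)%E.
Proof.
have [C C0 phiC] := phi_Delta'.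
have [M phiM] := moment_partial_sums sigmaP phi_moment.
pose S := 1 + C ^+ 2 * phi 2 * M.
have kaS N : \sum_(e < N) kappa sigma phi C e <= S.
  exact: kappa_sum_le.
have S0 : 0 < S.
  by apply: lt_le_trans (kaS 1%N); rewrite big_ord_recl big_ord0 addr0 /kappa/=.
have c0 := density_min_gt0 sigmaP.
exists (2 * S / density_min sigma) => [|f [acf [mf' _]] lambda l0 n hn].
  by rewrite divr_gt0// mulr_gt0.
apply: le_trans (modular_kantorovich_le ab sigmaP phiP phi_convex C0 phiC kaS
  acf mf' l0 hn) _.
apply: lee_wpmul2l.
  by rewrite lee_fin divr_ge0 ?(ltW c0)// mulr_ge0 ?(ltW S0).
apply: ge0_integral_mono => x _; first by rewrite lee_fin (phi_ge0 phiP).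
rewrite lee_fin; apply: (phi_le phiP) => //.
rewrite !normrM ler_wpM2r// ler_wpM2r// ler_wpM2r//.
rewrite -[leLHS]mulr1 ler_wpM2l//.
by rewrite -expr2 exprn_ege1// (le_trans L_ge1)// ler_norm.
Qed.
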